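(* Let $H\in\mathcal{C}$ be a Hopf algebra. Let $\mathcal{A}$ be the category whose objects are pairs $(A,\sigma)$, where $A$ is a measuring on $\overline{H}$ and $\sigma:\overline{H}\otimes\overline{H}\to A$ is a cocycle, and whose morphisms $f:(A,\sigma)\to(A',\sigma')$ are the measuring morphisms $f:A\to A'$ with $f\sigma=\sigma'$. Let $\mathcal{B}$ be the category whose objects are pairs $(B,\gamma)$ of an $\overline{H}$-cleft extension $B$ and a section $\gamma:\overline{H}\to B$ (normalized by $\gamma\overline{\eta}=\eta_B$), and whose morphisms $f:(B,\gamma)\to(B',\gamma')$ are the $\overline{H}$-comodule algebra morphisms $f:B\to B'$ with $f\gamma=\gamma'$. Then $\mathcal{A}$ and $\mathcal{B}$ are equivalent categories. An equivalence is given by the following functors: (a) $F:\mathcal{A}\to\mathcal{B}$ maps an object $(A,\sigma)$ to $(A\#_\sigma\overline{H},\,\eta_A\otimes\mathrm{id})$ and a morphism $f:(A,\sigma)\to(A',\sigma')$ to $f\otimes\mathrm{id}:(A\#_\sigma\overline{H},\eta_A\otimes\mathrm{id})\to(A'\#_{\sigma'}\overline{H},\eta_{A'}\otimes\mathrm{id})$. (b) $G:\mathcal{B}\to\mathcal{A}$ maps an object $(B,\gamma)$ to $(B^{\mathrm{co}\overline{H}},\sigma_\gamma)$ and a morphism $f:(B,\gamma)\to(B',\gamma')$ to the unique morphism $G(f):B^{\mathrm{co}\overline{H}}\to B'^{\,\mathrm{co}\overline{H}}$ with $\iota_{B'}G(f)=f\iota_B$, where $\iota_B,\iota_{B'}$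 are the equalizer morphisms.
   Context: Setting. $\mathcal{C},\mathcal{D}$ are strict monoidal categories, $\mathcal{D}$ has equalizers, $\mathbf{1}$ is the unit object of $\mathcal{C}$, and $\overline{\,\cdot\,}:\mathcal{C}\to\mathcal{D}$ is a strict monoidal functor with a left braiding $c$: a family of isomorphisms $c_{X,V}:\overline{X}\otimes V\to V\otimes\overline{X}$ in $\mathcal{D}$ ($X\in\mathcal{C}$, $V\in\mathcal{D}$), natural in $X$ and $V$ (i.e. $c_{Y,W}(\overline{f}\otimes g)=(g\otimes\overline{f})c_{X,V}$ for $f:X\to Y$ in $\mathcal{C}$, $g:V\to W$ in $\mathcal{D}$), with $c_{X\otimes Y,V}=(c_{X,V}\otimes\mathrm{id})(\mathrm{id}\otimes c_{Y,V})$ and $c_{X,V\otimes W}=(\mathrm{id}\otimes c_{X,W})(c_{X,V}\otimes\mathrm{id})$. Composition is written as juxtaposition. Algebras ($\mu_A,\eta_A$) and coalgebras ($\Delta_C,\varepsilon_C$) in a monoidal category are defined as usual. If $A$ is an algebra in $\mathcal{D}$ and $B$ an algebra in $\mathcal{C}$, then $A\otimes\overline{B}$ is an algebra in $\mathcal{D}$ with unit $\eta_A\otimes\overline{\eta_B}$ and multiplication $(\mu_A\otimes\overline{\mu_B})(\mathrm{id}\otimes c_{B,A}\otimes\mathrm{id})$. If $A$ is a coalgebra in $\mathcal{D}$ and $B$ a coalgebra in $\mathcal{C}$, then $\overline{B}\otimes A$ is a coalgebra in $\mathcal{D}$ with counit $\overline{\varepsilon_B}\otimes\varepsilon_A$ and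 comultiplication $(\mathrm{id}\otimes c_{B,A}\otimes\mathrm{id})(\overline{\Delta_B}\otimes\Delta_A)$. For $f,g:C\to A$ from a coalgebra to an algebra, $f*g=\mu_A(f\otimes g)\Delta_C$; $f$ is convolution invertible if there is a morphism $f^-:C\to A$ with $f*f^-=\eta_A\varepsilon_C=f^-*f$. A bialgebra is an object $H\in\mathcal{C}$ that is an algebra and a coalgebra in $\mathcal{C}$, with structure morphisms $\mu,\eta,\Delta,\varepsilon$, such that $\overline{\mu}:\overline{H}\otimes\overline{H}\to\overline{H}$ and $\overline{\eta}:\overline{\mathbf{1}}\to\overline{H}$ are coalgebra morphisms in $\mathcal{D}$. It is a Hopf algebra if $\mathrm{id}_H:H\to H$ is convolution invertible in $\mathcal{C}$ (the inverse being the antipode). Write $\Delta_{\overline{H}\otimes\overline{H}}=(\mathrm{id}\otimes c_{H,\overline{H}}\otimes\mathrm{id})(\overline{\Delta}\otimes\overline{\Delta})$. A measuring on $\overline{H}$ is an algebra $A\in\mathcal{D}$ with a morphism $\nu_A:\overline{H}\otimes A\to A$ such that $\nu_A(\overline{\eta}\otimes\mathrm{id}_A)=\mathrm{id}_A$, $\nu_A(\mathrm{id}\otimes\eta_A)=\eta_A\overline{\varepsilon}$ and $\nu_A(\mathrm{id}\otimes\mu_A)=\mu_A(\nu_A\otimes\nu_A)(\mathrm{id}\otimes c_{H,A}\otimes\mathrm{id})(\overline{\Delta}\otimes\mathrm{id}_A\otimes\mathrm{id}_A)$. A measuring morphism $f:A\to A'$ is an algebra morphism with $f\nu_A=\nu_{A'}(\mathrm{id}\otimes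 f)$. Put $c^\nu_{H,A}=(\nu_A\otimes\mathrm{id})(\mathrm{id}\otimes c_{H,A})(\overline{\Delta}\otimes\mathrm{id}):\overline{H}\otimes A\to A\otimes\overline{H}$. For a morphism $\sigma:\overline{H}\otimes\overline{H}\to A$ in $\mathcal{D}$ put $\hat\sigma=(\sigma\otimes\overline{\mu})\Delta_{\overline{H}\otimes\overline{H}}$ and $\mu_\sigma=(\mu_A\otimes\mathrm{id})(\mu_A\otimes\hat\sigma)(\mathrm{id}\otimes c^\nu_{H,A}\otimes\mathrm{id})$. $\sigma$ is a (two-)cocycle if it is convolution invertible and (i) $\mu_A(\mathrm{id}\otimes\sigma)(\hat\sigma\otimes\mathrm{id}_{\overline{H}})=\mu_A(\mathrm{id}\otimes\sigma)(c^\nu_{H,A}\otimes\mathrm{id})(\mathrm{id}_{\overline{H}}\otimes\hat\sigma)$, (ii) $\mu_A(\mathrm{id}\otimes\nu_A)(\hat\sigma\otimes\mathrm{id}_A)=\mu_A(\mathrm{id}\otimes\sigma)(c^\nu_{H,A}\otimes\mathrm{id})(\mathrm{id}_{\overline{H}}\otimes c^\nu_{H,A})$, (iii) $\sigma(\overline{\eta}\otimes\overline{\eta})=\eta_A$. For a cocycle $\sigma$, the crossed product $A\#_\sigma\overline{H}$ is the algebra $A\otimes\overline{H}$ with multiplication $\mu_\sigma$ and unit $\eta_A\otimes\overline{\eta}$; it is an $\overline{H}$-comodule algebra with coaction $\mathrm{id}_A\otimes\overline{\Delta}$. An $\overline{H}$-comodule algebra is an algebra $B\in\mathcal{D}$ that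 is a right $\overline{H}$-comodule whose coaction $\rho_B:B\to B\otimes\overline{H}$ is an algebra morphism. The coinvariants $\iota_B:B^{\mathrm{co}\overline{H}}\to B$ are the equalizer of $\rho_B$ and $\mathrm{id}\otimes\overline{\eta}$; $B^{\mathrm{co}\overline{H}}$ has the unique algebra structure making $\iota_B$ an algebra morphism. $B$ is an $\overline{H}$-cleft extension if there is a convolution invertible morphism of comodules $\gamma:\overline{H}\to B$, called a section. For an $\overline{H}$-cleft extension $B$ with normalized section $\gamma$, $B^{\mathrm{co}\overline{H}}$ is a measuring on $\overline{H}$ via the unique $\nu$ with $\iota_B\nu=\mu_B(\mu_B\otimes\mathrm{id})(\gamma\otimes\mathrm{id}\otimes\gamma^-)(\mathrm{id}\otimes c_{H,B})(\overline{\Delta}\otimes\iota_B)$, and $\sigma_\gamma:\overline{H}\otimes\overline{H}\to B^{\mathrm{co}\overline{H}}$ is the unique morphism with $\iota_B\sigma_\gamma=(\mu_B(\gamma\otimes\gamma))*(\gamma^-\,\overline{\mu})$; it is a cocycle. *)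

(* Defs.v *)
From Stdlib Require Import ProofIrrelevance.

Set Implicit Arguments.
Unset Strict Implicit.
Unset Printing Implicit Defensive.

Declare Scope cat_scope.
Delimit Scope cat_scope with cat.
Open Scope cat_scope.

Reserved Notation "g ∘ f" (at level 50, left associativity).
Reserved Notation "g ⊚ f" (at level 50, left associativity).
Reserved Notation "f ≡ g" (at level 70, no associativity).
Reserved Notation "X ⊗ Y" (at level 40, left associativity).
Reserved Notation "f ⊠ g" (at level 40, left associativity).

(** * Categories, functors, equivalences *)

Record category := Category {
  ob :> Type;
  hom : ob -> ob -> Type;
  idm : forall X, hom X X;
  comp : forall X Y Z, hom Y Z -> hom X Y -> hom X Z;
  comp_idl : forall X Y (f : hom X Y), comp (idm Y) f = f;
  comp_idr : forall X Y (f : hom X Y), comp f (idm X) = f;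
  compA : forall W X Y Z (h : hom Y Z) (g : hom X Y) (f : hom W X),
    comp h (comp g f) = comp (comp h g) f }.

Arguments hom {c} X Y.
Arguments idm {c} X.
Arguments comp {c X Y Z} g f.
Notation "g ∘ f" := (comp g f) : cat_scope.

Definition is_iso (C : category) (X Y : C) (f : hom X Y) : Prop :=
  exists g : hom Y X, g ∘ f = idm X /\ f ∘ g = idm Y.

Record functor (C D : category) := Functor {
  fob :> C -> D;
  fmap : forall X Y, hom X Y -> hom (fob X) (fob Y);
  fmap_id : forall X, fmap (idm X) = idm (fob X);
  fmap_comp : forall X Y Z (g : hom Y Z) (f : hom X Y),
    fmap (g ∘ f) = fmap g ∘ fmap f }.

Arguments fmap {C D} F {X Y} f : rename.

Definition functor_id (C : category) : functor C C :=
  @Functor C C (fun X => X) (fun _ _ f => f)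
    (fun _ => eq_refl) (fun _ _ _ _ _ => eq_refl).

Definition functor_comp (C D E : category) (G : functor D E) (F : functor C D) :
  functor C E.
Proof.
refine (@Functor C E (fun X => G (F X)) (fun _ _ f => fmap G (fmap F f)) _ _).
- intros X; rewrite !fmap_id; reflexivity.
- intros X Y Z g f; rewrite !fmap_comp; reflexivity.
Defined.

Definition naturally_isomorphic (C D : category) (F G : functor C D) : Prop :=
  exists t : forall X : C, hom (F X) (G X),
    (forall X, is_iso (t X)) /\
    (forall X Y (f : hom X Y), t Y ∘ fmap F f = fmap G f ∘ t X).

Definition is_equivalence (C D : category) (F : functor C D) (G : functor D C) :
  Prop :=
  naturally_isomorphic (functor_comp G F) (functor_id C) /\
  naturally_isomorphic (functor_comp F G) (functor_id D).

(* The lift is a datum, so that equalizer objects and induced morphisms are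
   chosen once and for all; the choice is arbitrary. *)
Record equalizers (D : category) := Equalizers {
  eqz_ob : forall (X Y : D) (f g : hom X Y), D;
  eqz_mor : forall (X Y : D) (f g : hom X Y), hom (eqz_ob f g) X;
  eqz_eq : forall (X Y : D) (f g : hom X Y),
    f ∘ eqz_mor f g = g ∘ eqz_mor f g;
  eqz_lift : forall (X Y : D) (f g : hom X Y) (Z : D) (h : hom Z X),
    f ∘ h = g ∘ h -> hom Z (eqz_ob f g);
  eqz_liftK : forall (X Y : D) (f g : hom X Y) (Z : D) (h : hom Z X)
    (e : f ∘ h = g ∘ h), eqz_mor f g ∘ eqz_lift e = h;
  eqz_uniq : forall (X Y : D) (f g : hom X Y) (Z : D)
    (k l : hom Z (eqz_ob f g)),
    eqz_mor f g ∘ k = eqz_mor f g ∘ l -> k = l }.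

(** * Strictness *)

(* In a strict monoidal category (X ⊗ Y) ⊗ Z and X ⊗ (Y ⊗ Z) are equal but not
   convertible, so equations between composites need morphisms to be compared
   and composed across equalities of objects.
   - f ≡ g says that f and g are equal as arrows, i.e. as triples
     (source, target, morphism); in particular their sources and targets are
     equal, and f ≡ g amounts to f = g when these coincide on the nose.
   - g ⊚ f is the composite when the target of f equals the source of g; the
     equality is found by instance search, using the strictness axioms.
   - castm f is f with source and target replaced by equal objects. *)

Record arrow (C : category) := Arrow { src : C; tgt : C; arr : hom src tgt }.

Definition arr_eq (C : category) (X Y X' Y' : C) (f : hom X Y) (g : hom X' Y') :
  Prop := Arrow f = Arrow g.
Notation "f ≡ g" := (arr_eq f g) : cat_scope.

Class ob_eq (T : Type) (X Y : T) : Prop := ob_eqP : X = Y.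
Arguments ob_eqP {T X Y} _.

Definition castm (C : category) (X Y X' Y' : C)
    {ex : ob_eq X X'} {ey : ob_eq Y Y'} (f : hom X Y) : hom X' Y' :=
  eq_rect Y (fun T => hom X' T) (eq_rect X (fun S => hom S Y) f X' ex) Y' ey.
Arguments castm {C X Y X' Y' ex ey} f.

Definition ccomp (C : category) (X Y Y' Z : C) {e : ob_eq Y Y'}
    (g : hom Y' Z) (f : hom X Y) : hom X Z :=
  g ∘ eq_rect Y (fun T => hom X T) f Y' e.
Arguments ccomp {C X Y Y' Z e} g f.
Notation "g ⊚ f" := (ccomp g f) : cat_scope.

Create HintDb strict discriminated.
Ltac strict_eq :=
  match goal with |- @ob_eq ?T ?X ?Y => change (@eq T X Y) end;
  cbn; autorewrite with strict; reflexivity.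
#[global] Hint Extern 0 (ob_eq _ _) => strict_eq : typeclass_instances.

(** * Strict monoidal categories and functors, left braidings *)

Record monoidal_data := MonoidalData {
  md_cat :> category;
  tens : md_cat -> md_cat -> md_cat;
  unit_ob : md_cat;
  tensm : forall X X' Y Y' : md_cat,
    hom X X' -> hom Y Y' -> hom (tens X Y) (tens X' Y') }.

Arguments tens {m} X Y.
Arguments unit_ob {m}.
Arguments tensm {m X X' Y Y'} f g.
Notation "X ⊗ Y" := (tens X Y) : cat_scope.
Notation "f ⊠ g" := (tensm f g) : cat_scope.

Record strict_monoidal := StrictMonoidal {
  sm_data :> monoidal_data;
  tens_id : forall X Y : sm_data, idm X ⊠ idm Y = idm (X ⊗ Y);
  tens_comp : forall (X X' X'' Y Y' Y'' : sm_data)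
    (f' : hom X' X'') (f : hom X X') (g' : hom Y' Y'') (g : hom Y Y'),
    (f' ∘ f) ⊠ (g' ∘ g) = (f' ⊠ g') ∘ (f ⊠ g);
  tensA : forall X Y Z : sm_data, X ⊗ (Y ⊗ Z) = (X ⊗ Y) ⊗ Z;
  tens1X : forall X : sm_data, unit_ob ⊗ X = X;
  tensX1 : forall X : sm_data, X ⊗ unit_ob = X;
  tensmA : forall (X X' Y Y' Z Z' : sm_data)
    (f : hom X X') (g : hom Y Y') (h : hom Z Z'),
    f ⊠ (g ⊠ h) ≡ (f ⊠ g) ⊠ h;
  tensm1f : forall (X X' : sm_data) (f : hom X X'), idm unit_ob ⊠ f ≡ f;
  tensmf1 : forall (X X' : sm_data) (f : hom X X'), f ⊠ idm unit_ob ≡ f }.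

Global Hint Rewrite tensA tens1X tensX1 : strict.

Record strict_monoidal_functor (C D : strict_monoidal) := StrictMonoidalFunctor {
  smf_functor :> functor C D;
  smf_tens : forall X Y : C, smf_functor (X ⊗ Y) = smf_functor X ⊗ smf_functor Y;
  smf_unit : smf_functor unit_ob = unit_ob;
  smf_tensm : forall (X X' Y Y' : C) (f : hom X X') (g : hom Y Y'),
    fmap smf_functor (f ⊠ g) ≡ fmap smf_functor f ⊠ fmap smf_functor g }.

Global Hint Rewrite smf_tens smf_unit : strict.

Record left_braiding (C D : strict_monoidal)
    (bar : strict_monoidal_functor C D) := LeftBraiding {
  braid :> forall (X : C) (V : D), hom (bar X ⊗ V) (V ⊗ bar X);
  braid_iso : forall X V, is_iso (braid X V);
  braid_nat : forall (X Y : C) (V W : D) (f : hom X Y) (g : hom V W),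
    braid Y W ∘ (fmap bar f ⊠ g) = (g ⊠ fmap bar f) ∘ braid X V;
  braid_tensl : forall (X Y : C) (V : D),
    braid (X ⊗ Y) V ≡ (braid X V ⊠ idm (bar Y)) ⊚ (idm (bar X) ⊠ braid Y V);
  braid_tensr : forall (X : C) (V W : D),
    braid X (V ⊗ W) ≡ (idm V ⊠ braid X W) ⊚ (braid X V ⊠ idm W) }.

(** * Algebras, coalgebras, convolution *)

(* Structures are split into data and a predicate on them, so that functors can
   be specified by the data they produce. *)

Record alg_data (M : strict_monoidal) := AlgData {
  alg_ob :> M;
  mul : hom (alg_ob ⊗ alg_ob) alg_ob;
  unit : hom unit_ob alg_ob }.

Record coalg_data (M : strict_monoidal) := CoalgData {
  coalg_ob :> M;
  comul : hom coalg_ob (coalg_ob ⊗ coalg_ob);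
  counit : hom coalg_ob unit_ob }.

Arguments mul {M} A : rename.
Arguments unit {M} A : rename.
Arguments comul {M} A : rename.
Arguments counit {M} A : rename.

Section Monoidal.
Context {M : strict_monoidal}.

Definition is_algebra (A : alg_data M) : Prop :=
  mul A ⊚ (mul A ⊠ idm A) ≡ mul A ⊚ (idm A ⊠ mul A) /\
  mul A ⊚ (unit A ⊠ idm A) ≡ idm A /\
  mul A ⊚ (idm A ⊠ unit A) ≡ idm A.

Definition is_coalgebra (A : coalg_data M) : Prop :=
  (comul A ⊠ idm A) ⊚ comul A ≡ (idm A ⊠ comul A) ⊚ comul A /\
  (counit A ⊠ idm A) ⊚ comul A ≡ idm A /\
  (idm A ⊠ counit A) ⊚ comul A ≡ idm A.

Definition is_alg_mor (A B : alg_data M) (f : hom A B) : Prop :=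
  f ∘ mul A = mul B ∘ (f ⊠ f) /\ f ∘ unit A = unit B.

Definition is_coalg_mor (A B : coalg_data M) (f : hom A B) : Prop :=
  comul B ∘ f = (f ⊠ f) ∘ comul A /\ counit B ∘ f = counit A.

Definition conv (K : coalg_data M) (A : alg_data M) (f g : hom K A) : hom K A :=
  mul A ∘ (f ⊠ g) ∘ comul K.

Definition is_conv_inverse (K : coalg_data M) (A : alg_data M)
    (f f' : hom K A) : Prop :=
  conv f f' = unit A ∘ counit K /\ conv f' f = unit A ∘ counit K.

Definition conv_invertible (K : coalg_data M) (A : alg_data M)
    (f : hom K A) : Prop :=
  exists f', is_conv_inverse f f'.

Definition unit_coalg : coalg_data M :=
  @CoalgData M unit_ob (castm (idm unit_ob)) (idm unit_ob).

Definition is_comodule (K : coalg_data M) (V : M) (rho : hom V (V ⊗ K)) : Prop :=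
  (rho ⊠ idm K) ⊚ rho ≡ (idm V ⊠ comul K) ⊚ rho /\
  (idm V ⊠ counit K) ⊚ rho ≡ idm V.

Definition is_comodule_mor (K : coalg_data M) (V W : M)
    (rV : hom V (V ⊗ K)) (rW : hom W (W ⊗ K)) (f : hom V W) : Prop :=
  rW ∘ f = (f ⊠ idm K) ∘ rV.

End Monoidal.

Section LeftBraided.
Context {C D : strict_monoidal} {bar : strict_monoidal_functor C D}.
Context (c : left_braiding bar).

Definition bar_coalg (B : coalg_data C) : coalg_data D :=
  @CoalgData D (bar B) (castm (fmap bar (comul B))) (castm (fmap bar (counit B))).

(* A ⊗ bar B *)
Definition tens_alg (A : alg_data D) (B : alg_data C) : alg_data D :=
  @AlgData D (A ⊗ bar B)
    (castm ((mul A ⊠ fmap bar (mul B)) ⊚ (idm A ⊠ c B A ⊠ idm (bar B))))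
    (castm (unit A ⊠ fmap bar (unit B))).

(* bar B ⊗ A *)
Definition tens_coalg (B : coalg_data C) (A : coalg_data D) : coalg_data D :=
  @CoalgData D (bar B ⊗ A)
    (castm ((idm (bar B) ⊠ c B A ⊠ idm A) ⊚ (fmap bar (comul B) ⊠ comul A)))
    (castm (fmap bar (counit B) ⊠ counit A)).

End LeftBraided.

(** * Hopf algebras *)

Record bialg_data (M : strict_monoidal) := BialgData {
  bialg_ob :> M;
  bmul : hom (bialg_ob ⊗ bialg_ob) bialg_ob;
  bunit : hom unit_ob bialg_ob;
  bcomul : hom bialg_ob (bialg_ob ⊗ bialg_ob);
  bcounit : hom bialg_ob unit_ob }.

Definition bialg_alg (M : strict_monoidal) (H : bialg_data M) : alg_data M :=
  @AlgData M H (bmul H) (bunit H).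
Definition bialg_coalg (M : strict_monoidal) (H : bialg_data M) : coalg_data M :=
  @CoalgData M H (bcomul H) (bcounit H).

Section Crossed.
Context {C D : strict_monoidal} {bar : strict_monoidal_functor C D}.
Context (c : left_braiding bar) (H : bialg_data C).

Local Notation Hb := (fob bar (bialg_ob H)).
Local Notation idH := (idm Hb).

Definition mulH : hom (Hb ⊗ Hb) Hb := castm (fmap bar (bmul H)).
Definition unitH : hom unit_ob Hb := castm (fmap bar (bunit H)).
Definition coalgH : coalg_data D := bar_coalg (bar := bar) (bialg_coalg H).
Definition comulH : hom Hb (Hb ⊗ Hb) := comul coalgH.
Definition counitH : hom Hb unit_ob := counit coalgH.
Definition coalgHH : coalg_data D := tens_coalg c (bialg_coalg H) coalgH.

Definition is_bialgebra : Prop :=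
  is_algebra (bialg_alg H) /\ is_coalgebra (bialg_coalg H) /\
  @is_coalg_mor D coalgHH coalgH mulH /\
  @is_coalg_mor D unit_coalg coalgH unitH.

Definition is_hopf_algebra : Prop :=
  is_bialgebra /\
  @conv_invertible C (bialg_coalg H) (bialg_alg H) (idm (bialg_ob H)).

(** * Measurings and cocycles *)

Record measuring_data := MeasuringData {
  meas_alg :> alg_data D;
  act : hom (Hb ⊗ meas_alg) meas_alg }.

Definition is_measuring (A : measuring_data) : Prop :=
  is_algebra A /\
  act A ⊚ (unitH ⊠ idm A) ≡ idm A /\
  act A ⊚ (idH ⊠ unit A) ≡ unit A ∘ counitH /\
  act A ⊚ (idH ⊠ mul A) ≡
    mul A ⊚ (act A ⊠ act A) ⊚ (idH ⊠ c H A ⊠ idm A)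
      ⊚ (comulH ⊠ idm A ⊠ idm A).

Definition is_measuring_mor (A A' : measuring_data) (f : hom A A') : Prop :=
  is_alg_mor f /\ f ∘ act A = act A' ∘ (idH ⊠ f).

Definition cnu (A : measuring_data) : hom (Hb ⊗ A) (A ⊗ Hb) :=
  (act A ⊠ idH) ⊚ (idH ⊠ c H A) ⊚ (comulH ⊠ idm A).

Record cocycle_data := CocycleData {
  coc_meas :> measuring_data;
  coc : hom (Hb ⊗ Hb) coc_meas }.

Definition coc_hat (A : cocycle_data) : hom (Hb ⊗ Hb) (A ⊗ Hb) :=
  (coc A ⊠ mulH) ∘ comul coalgHH.

Definition is_cocycle (A : cocycle_data) : Prop :=
  @conv_invertible D coalgHH A (coc A) /\
  mul A ⊚ (idm A ⊠ coc A) ⊚ (coc_hat A ⊠ idH) ≡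
    mul A ⊚ (idm A ⊠ coc A) ⊚ (cnu A ⊠ idH) ⊚ (idH ⊠ coc_hat A) /\
  mul A ⊚ (idm A ⊠ act A) ⊚ (coc_hat A ⊠ idm A) ≡
    mul A ⊚ (idm A ⊠ coc A) ⊚ (cnu A ⊠ idH) ⊚ (idH ⊠ cnu A) /\
  coc A ∘ (unitH ⊠ unitH) ≡ unit A.

Definition is_measuring_cocycle (A : cocycle_data) : Prop :=
  is_measuring A /\ is_cocycle A.

Definition is_cocycle_mor (A A' : cocycle_data) (f : hom A A') : Prop :=
  is_measuring_mor f /\ f ∘ coc A = coc A'.

(** * Cleft extensions *)

Record coact_data := CoactData {
  coact_alg :> alg_data D;
  coact : hom coact_alg (coact_alg ⊗ Hb) }.

Definition is_comodule_algebra (B : coact_data) : Prop :=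
  is_algebra B /\ @is_comodule D coalgH B (coact B) /\
  @is_alg_mor D B (tens_alg c B (bialg_alg H)) (coact B).

Definition is_section (B : coact_data) (gamma : hom Hb B) : Prop :=
  @is_comodule_mor D coalgH Hb B comulH (coact B) gamma /\
  @conv_invertible D coalgH B gamma.

Definition is_cleft_extension (B : coact_data) : Prop :=
  is_comodule_algebra B /\ exists gamma, is_section (B := B) gamma.

Record cleft_data := CleftData {
  cleft_coact :> coact_data;
  sect : hom Hb cleft_coact }.

Definition is_cleft_pair (B : cleft_data) : Prop :=
  is_cleft_extension B /\ is_section (sect B) /\ sect B ∘ unitH = unit B.

Definition is_cleft_mor (B B' : cleft_data) (f : hom B B') : Prop :=
  is_alg_mor f /\ @is_comodule_mor D coalgH B B' (coact B) (coact B') f /\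
  f ∘ sect B = sect B'.

(** * The categories of cocycles and of cleft extensions *)

Lemma sig_eq (T : Type) (P : T -> Prop) (u v : {x : T | P x}) :
  proj1_sig u = proj1_sig v -> u = v.
Proof.
destruct u as [x p], v as [y q]; cbn; intros e; subst y.
f_equal; apply proof_irrelevance.
Qed.

Lemma tens_comp_idl (X : D) (Y Y' Y'' : D) (g : hom Y' Y'') (f : hom Y Y') :
  idm X ⊠ (g ∘ f) = (idm X ⊠ g) ∘ (idm X ⊠ f).
Proof. rewrite <- tens_comp, comp_idl; reflexivity. Qed.

Lemma tens_comp_idr (X : D) (Y Y' Y'' : D) (g : hom Y' Y'') (f : hom Y Y') :
  (g ∘ f) ⊠ idm X = (g ⊠ idm X) ∘ (f ⊠ idm X).
Proof. rewrite <- tens_comp, comp_idl; reflexivity. Qed.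

Lemma alg_mor_id (A : alg_data D) : @is_alg_mor D A A (idm A).
Proof.
split; rewrite ?tens_id, ?comp_idl, ?comp_idr; reflexivity.
Qed.

Lemma alg_mor_comp (A A' A'' : alg_data D) (g : hom A' A'') (f : hom A A') :
  is_alg_mor g -> is_alg_mor f -> is_alg_mor (g ∘ f).
Proof.
intros [gm gu] [fm fu]; split.
- rewrite <- compA, fm, compA, gm, tens_comp, compA; reflexivity.
- rewrite <- compA, fu, gu; reflexivity.
Qed.

Lemma cocycle_mor_id (A : cocycle_data) : @is_cocycle_mor A A (idm A).
Proof.
split; [split; [apply alg_mor_id|]|];
  rewrite ?tens_id, ?comp_idl, ?comp_idr; reflexivity.
Qed.

Lemma cocycle_mor_comp (A A' A'' : cocycle_data)
    (g : hom A' A'') (f : hom A A') :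
  is_cocycle_mor g -> is_cocycle_mor f -> is_cocycle_mor (g ∘ f).
Proof.
intros [[ga gn] gs] [[fa fn] fs]; split; [split; [apply alg_mor_comp; assumption|]|].
- rewrite <- compA, fn, compA, gn, tens_comp_idl, compA; reflexivity.
- rewrite <- compA, fs, gs; reflexivity.
Qed.

Lemma cleft_mor_id (B : cleft_data) : @is_cleft_mor B B (idm B).
Proof.
split; [apply alg_mor_id|]; unfold is_comodule_mor; cbn;
  split; rewrite ?tens_id, ?comp_idl, ?comp_idr; reflexivity.
Qed.

Lemma cleft_mor_comp (B B' B'' : cleft_data)
    (g : hom B' B'') (f : hom B B') :
  is_cleft_mor g -> is_cleft_mor f -> is_cleft_mor (g ∘ f).
Proof.
unfold is_cleft_mor, is_comodule_mor; cbn.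
intros [ga [gr gs]] [fa [fr fs]].
split; [apply alg_mor_comp; assumption|split].
- rewrite compA, gr, <- compA, fr, compA, tens_comp_idr; reflexivity.
- rewrite <- compA, fs, gs; reflexivity.
Qed.

Definition cocycle_ob := {A : cocycle_data | is_measuring_cocycle A}.
Definition cocycle_hom (x y : cocycle_ob) :=
  {f : hom (proj1_sig x) (proj1_sig y) | is_cocycle_mor f}.

Definition cocycle_cat : category.
Proof.
refine (@Category cocycle_ob cocycle_hom
  (fun x => exist _ (idm _) (cocycle_mor_id (proj1_sig x)))
  (fun x y z g f => exist _ (proj1_sig g ∘ proj1_sig f)
     (cocycle_mor_comp (proj2_sig g) (proj2_sig f))) _ _ _);
  intros; apply sig_eq; cbn; [apply comp_idl | apply comp_idr | apply compA].
Defined.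

Definition cleft_ob := {B : cleft_data | is_cleft_pair B}.
Definition cleft_hom (x y : cleft_ob) :=
  {f : hom (proj1_sig x) (proj1_sig y) | is_cleft_mor f}.

Definition cleft_cat : category.
Proof.
refine (@Category cleft_ob cleft_hom
  (fun x => exist _ (idm _) (cleft_mor_id (proj1_sig x)))
  (fun x y z g f => exist _ (proj1_sig g ∘ proj1_sig f)
     (cleft_mor_comp (proj2_sig g) (proj2_sig f))) _ _ _);
  intros; apply sig_eq; cbn; [apply comp_idl | apply comp_idr | apply compA].
Defined.

Definition cocycle_data_of (x : cocycle_cat) : cocycle_data := proj1_sig x.
Definition cleft_data_of (x : cleft_cat) : cleft_data := proj1_sig x.
Definition cocycle_mor_of (x y : cocycle_cat) (f : hom x y) :
  hom (cocycle_data_of x) (cocycle_data_of y) := proj1_sig f.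
Definition cleft_mor_of (x y : cleft_cat) (f : hom x y) :
  hom (cleft_data_of x) (cleft_data_of y) := proj1_sig f.

(** * The crossed product and the coinvariants *)

Definition crossed_mul (A : cocycle_data) :
    hom ((A ⊗ Hb) ⊗ (A ⊗ Hb)) (A ⊗ Hb) :=
  castm ((mul A ⊠ idH) ⊚ (mul A ⊠ coc_hat A) ⊚ (idm A ⊠ cnu A ⊠ idH)).

Definition crossed_product (A : cocycle_data) : cleft_data :=
  @CleftData
    (@CoactData
       (@AlgData D (A ⊗ Hb) (crossed_mul A) (castm (unit A ⊠ unitH)))
       (castm (idm A ⊠ comulH)))
    (castm (unit A ⊠ idH)).

Context (E : equalizers D).

Definition coinv (B : coact_data) : D :=
  eqz_ob E (coact B) (castm (idm B ⊠ unitH)).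
Definition coinv_mor (B : coact_data) : hom (coinv B) B :=
  eqz_mor E (coact B) (castm (idm B ⊠ unitH)).

(* [is_coinv_cocycle B A]: A is the measuring with cocycle (B^{co H}, sigma_gamma)
   attached to (B, gamma).  Every structure morphism is characterised, as the
   unique one, by its composite with the equalizer morphism; the convolution
   inverse g' of gamma is unique when it exists. *)
Inductive is_coinv_cocycle (B : cleft_data) : cocycle_data -> Prop :=
| CoinvCocycle
    (g' : hom Hb B)
    (m : hom (coinv B ⊗ coinv B) (coinv B))
    (u : hom unit_ob (coinv B))
    (nu : hom (Hb ⊗ coinv B) (coinv B))
    (s : hom (Hb ⊗ Hb) (coinv B)) :
    @is_conv_inverse D coalgH B (sect B) g' ->
    unique (fun m => coinv_mor B ∘ m = mul B ∘ (coinv_mor B ⊠ coinv_mor B)) m ->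
    unique (fun u => coinv_mor B ∘ u = unit B) u ->
    unique (fun nu => coinv_mor B ∘ nu =
      mul B ⊚ (mul B ⊠ idm B) ⊚ (sect B ⊠ idm B ⊠ g')
        ⊚ (idH ⊠ c H B) ⊚ (comulH ⊠ coinv_mor B)) nu ->
    unique (fun s => coinv_mor B ∘ s =
      @conv D coalgHH B (mul B ∘ (sect B ⊠ sect B)) (g' ∘ mulH)) s ->
    is_coinv_cocycle B
      (@CocycleData (@MeasuringData (@AlgData D (coinv B) m u) nu) s).

End Crossed.

(* Main.v *)
(* Write K for the image of H.
   A morphism f : C -> A is convolution invertible exactly when the left A-linear,
   right C-colinear endomorphism a ⊗ c |-> a f(c1) ⊗ c2 of A ⊗ C is invertible.

   Given (A, σ), let T(h ⊗ a) = h1·a ⊗ h2 and S(h ⊗ l) = σ(h1 ⊗ l1) ⊗ h2 l2.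
   These maps are colinear into the cofree comodule A ⊗ K, so the measuring and cocycle axioms lift to
   identities between T and S with values in A ⊗ K, and these give the associativity of
   the crossed product; its multiplication is colinear because T and S are.

   Given (B, γ), the map p(b) = b0 γ^-(b1) retracts B onto its coinvariants A, and
   Ψ(a ⊗ h) = a γ(h) is an isomorphism A ⊗ K -> B with inverse b |-> p(b0) ⊗ b1.  Since
   Ψ(T(h ⊗ a)) = γ(h) a and Ψ(S(h ⊗ l)) = γ(h) γ(l), all axioms on (A, σ) follow from the
   associativity of B.
   Moreover a ⊗ h ⊗ l |-> Ψ(a ⊗ h) γ(l1) ⊗ l2 is the map attached to σ
   followed by the Galois map h ⊗ l |-> h l1 ⊗ l2 of K and by Ψ ⊗ K, so σ is convolution
   invertible if and only if γ is; this serves in both directions of the equivalence.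

   The natural isomorphisms are Ψ and the lift of a |-> a ⊗ 1 through the equalizer. *)
From Stdlib Require Import ProofIrrelevance IndefiniteDescription.
Require Import Defs.

Set Implicit Arguments.
Unset Strict Implicit.
Unset Printing Implicit Defensive.

(** * Equality of arrows *)

Lemma arr_eq_src (M : category) (X Y X' Y' : M) (f : hom X Y) (g : hom X' Y') :
  f ≡ g -> X = X'.
Proof. intros e; exact (f_equal (@src M) e). Qed.

Lemma arr_eq_tgt (M : category) (X Y X' Y' : M) (f : hom X Y) (g : hom X' Y') :
  f ≡ g -> Y = Y'.
Proof. intros e; exact (f_equal (@tgt M) e). Qed.

(** The morphism sits in two nested dependent pairs, over the source and over the target; stripping
    them uses uniqueness of identity proofs, which follows from proof irrelevance. *)
Lemma arr_eq_eq (M : category) (X Y : M) (f g : hom X Y) : f ≡ g -> f = g.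
Proof.
intros e; injection e; intros h.
apply ProofIrrelevanceTheory.EqdepTheory.inj_pair2 in h.
apply ProofIrrelevanceTheory.EqdepTheory.inj_pair2 in h; exact h.
Qed.

(** Meant for goals in which the objects are variables, so that the equalities of sources and
    targets can be substituted away. *)
Ltac arr_subst e :=
  let ex := fresh in let ey := fresh in
  pose proof (arr_eq_src e) as ex; pose proof (arr_eq_tgt e) as ey;
  subst; apply arr_eq_eq in e; subst.

Lemma arr_refl (M : category) (X Y : M) (f : hom X Y) : f ≡ f.
Proof. reflexivity. Qed.

Lemma arr_sym (M : category) (X Y X' Y' : M) (f : hom X Y) (g : hom X' Y') :
  f ≡ g -> g ≡ f.
Proof. intros e; symmetry; exact e. Qed.

Lemma arr_trans (M : category) (X Y X' Y' X'' Y'' : M)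
    (f : hom X Y) (g : hom X' Y') (h : hom X'' Y'') :
  f ≡ g -> g ≡ h -> f ≡ h.
Proof. intros e e'; exact (eq_trans e e'). Qed.

Lemma arr_comp (M : category) (X Y Z X' Y' Z' : M)
    (g : hom Y Z) (f : hom X Y) (g' : hom Y' Z') (f' : hom X' Y') :
  g ≡ g' -> f ≡ f' -> g ∘ f ≡ g' ∘ f'.
Proof. intros eg ef; arr_subst eg; arr_subst ef; reflexivity. Qed.

Lemma arr_ccomp (M : category) (X Y Y1 Z X' Y' Z' : M) (e : ob_eq Y Y1)
    (g : hom Y1 Z) (f : hom X Y) (g' : hom Y' Z') (f' : hom X' Y') :
  g ≡ g' -> f ≡ f' -> g ⊚ f ≡ g' ∘ f'.
Proof. unfold ob_eq in e; subst Y1; intros; apply arr_comp; assumption. Qed.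

Lemma arr_castm (M : category) (X Y X' Y' : M) (ex : ob_eq X X') (ey : ob_eq Y Y')
    (f : hom X Y) : castm f ≡ f.
Proof. unfold ob_eq in *; subst; reflexivity. Qed.

Lemma arr_idm (M : category) (X Y : M) : X = Y -> idm X ≡ idm Y.
Proof. intros e; subst; reflexivity. Qed.

Lemma arr_tens (M : strict_monoidal) (X Y X' Y' V W V' W' : M)
    (f : hom X Y) (f' : hom X' Y') (g : hom V W) (g' : hom V' W') :
  f ≡ f' -> g ≡ g' -> f ⊠ g ≡ f' ⊠ g'.
Proof. intros ef eg; arr_subst ef; arr_subst eg; reflexivity. Qed.

Lemma arr_fmap (M N : category) (F : functor M N) (X Y X' Y' : M)
    (f : hom X Y) (f' : hom X' Y') : f ≡ f' -> fmap F f ≡ fmap F f'.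
Proof. intros ef; arr_subst ef; reflexivity. Qed.

Lemma arr_iso (M : category) (X Y X' Y' : M) (f : hom X Y) (f' : hom X' Y') :
  f ≡ f' -> is_iso f -> is_iso f'.
Proof. intros ef; arr_subst ef; trivial. Qed.

(** * Left whiskering *)

(* A morphism f : X -> Y is studied through the family Z ⊗ f, natural in Z, whose source
   and target are rebracketed to the left: for f : X ⊗ X' -> Y it has components
   (Z ⊗ X) ⊗ X' -> Z ⊗ Y.  Composites of such components, whiskered by identities on
   the right, compose without transport along equalities of objects, and naturality in
   Z is the interchange law.  [is_lw Z f F] says that F is the component at Z, and
   [omn f Z] is this component when source and target of f have m and n factors. *)
Definition is_lw (M : strict_monoidal) (Z X Y P Q : M) (f : hom X Y) (F : hom P Q)
  : Prop := idm Z ⊠ f ≡ F.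

Section Families.
Context {D : strict_monoidal}.
Implicit Types X Y Z V W P Q : D.

Lemma lw_eq (Z X Y X' Y' P Q : D) (f : hom X Y) (g : hom X' Y') (F G : hom P Q) :
  f ≡ g -> is_lw Z f F -> is_lw Z g G -> F = G.
Proof.
intros e ef eg; arr_subst e; apply arr_eq_eq.
exact (arr_trans (arr_sym ef) eg).
Qed.

Lemma lw_eq0 (Z X Y P Q : D) (f g : hom X Y) (F G : hom P Q) :
  f = g -> is_lw Z f F -> is_lw Z g G -> F = G.
Proof. intros e; apply lw_eq; subst g; reflexivity. Qed.

(** The component at the unit object recovers the morphism, since tensoring with the unit is
    strictly the identity; so one component suffices to prove an equation of arrows. *)
Lemma lw_arr (X Y X' Y' P Q : D) (f : hom X Y) (g : hom X' Y') (F G : hom P Q) :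
  is_lw unit_ob f F -> is_lw unit_ob g G -> F = G -> f ≡ g.
Proof.
intros ef eg e; subst G.
apply (arr_trans (arr_sym (tensm1f f))).
apply (arr_trans ef).
exact (arr_trans (arr_sym eg) (tensm1f g)).
Qed.

Lemma lw_rhs (Z X Y P Q : D) (f : hom X Y) (F G : hom P Q) :
  is_lw Z f F -> F = G -> is_lw Z f G.
Proof. intros ef e; subst G; exact ef. Qed.

Lemma lw_change (Z X Y X' Y' P Q : D) (f : hom X Y) (g : hom X' Y') (F : hom P Q) :
  f ≡ g -> is_lw Z g F -> is_lw Z f F.
Proof. intros e; arr_subst e; trivial. Qed.

Lemma lw_id (Z X W : D) : ob_eq (Z ⊗ X) W -> is_lw Z (idm X) (idm W).
Proof. unfold ob_eq; intros e; subst W; unfold is_lw; rewrite tens_id; reflexivity. Qed.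

Lemma lw_comp (Z X Y V P Q R : D) (g : hom Y V) (f : hom X Y)
    (G : hom Q R) (F : hom P Q) :
  is_lw Z g G -> is_lw Z f F -> is_lw Z (g ∘ f) (G ∘ F).
Proof.
unfold is_lw; intros eg ef; rewrite tens_comp_idl; apply arr_comp; assumption.
Qed.

Lemma lw_ccomp (Z X Y Y1 V P Q R : D) (e : ob_eq Y Y1) (g : hom Y1 V) (f : hom X Y)
    (G : hom Q R) (F : hom P Q) :
  is_lw Z g G -> is_lw Z f F -> is_lw Z (g ⊚ f) (G ∘ F).
Proof. unfold ob_eq in e; subst Y1; apply lw_comp. Qed.

Lemma lw_castm (Z X Y X' Y' P Q : D) (ex : ob_eq X X') (ey : ob_eq Y Y')
    (f : hom X Y) (F : hom P Q) : is_lw Z f F -> is_lw Z (castm f) F.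
Proof. apply lw_change, arr_castm. Qed.

Lemma lw_tensr (Z X Y P Q V : D) (f : hom X Y) (F : hom P Q) :
  is_lw Z f F -> is_lw Z (f ⊠ idm V) (F ⊠ idm V).
Proof.
unfold is_lw; intros ef; apply (arr_trans (tensmA _ _ _)).
apply arr_tens; [exact ef|reflexivity].
Qed.

Lemma lw_tensr1 (Z X Y P Q : D) (f : hom X Y) (F : hom P Q) :
  is_lw Z f F -> is_lw Z (f ⊠ idm unit_ob) F.
Proof. apply lw_change, tensmf1. Qed.

Lemma lw_tensrr (Z X Y P Q V W : D) (f : hom X Y) (F : hom P Q) :
  is_lw Z (f ⊠ idm V ⊠ idm W) F -> is_lw Z (f ⊠ idm (V ⊗ W)) F.
Proof.
apply lw_change; rewrite <- tens_id; apply tensmA.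
Qed.

Lemma lw_tensl (Z X Y V W P Q : D) (f : hom X Y) (F : hom P Q) :
  ob_eq (Z ⊗ V) W -> is_lw W f F -> is_lw Z (idm V ⊠ f) F.
Proof.
unfold ob_eq; intros e; subst W; unfold is_lw; intros ef.
apply (arr_trans (tensmA _ _ _)); rewrite tens_id; exact ef.
Qed.

Lemma tens_split (X Y X' Y' : D) (f : hom X Y) (g : hom X' Y') :
  f ⊠ g = (idm Y ⊠ g) ∘ (f ⊠ idm X').
Proof. rewrite <- tens_comp, comp_idl, comp_idr; reflexivity. Qed.

(** Fixes a convention: in a tensor product of two morphisms the left one acts first. Equations that
    arise in the other order are adjusted by the interchange law. *)
Lemma lw_tens (Z X Y X' Y' P Q R : D) (f : hom X Y) (g : hom X' Y')
    (G : hom Q R) (F : hom P Q) :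
  is_lw Z (idm Y ⊠ g) G -> is_lw Z (f ⊠ idm X') F -> is_lw Z (f ⊠ g) (G ∘ F).
Proof. rewrite (tens_split f g); apply lw_comp. Qed.

Definition o01 (X : D) (f : hom unit_ob X) (Z : D) : hom Z (Z ⊗ X) :=
  castm (idm Z ⊠ f).
Definition o10 (X : D) (f : hom X unit_ob) (Z : D) : hom (Z ⊗ X) Z :=
  castm (idm Z ⊠ f).
Definition o11 (X Y : D) (f : hom X Y) (Z : D) : hom (Z ⊗ X) (Z ⊗ Y) :=
  idm Z ⊠ f.
Definition o12 (X Y Y' : D) (f : hom X (Y ⊗ Y')) (Z : D) :
  hom (Z ⊗ X) (Z ⊗ Y ⊗ Y') := castm (idm Z ⊠ f).
Definition o21 (X X' Y : D) (f : hom (X ⊗ X') Y) (Z : D) :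
  hom (Z ⊗ X ⊗ X') (Z ⊗ Y) := castm (idm Z ⊠ f).
Definition o22 (X X' Y Y' : D) (f : hom (X ⊗ X') (Y ⊗ Y')) (Z : D) :
  hom (Z ⊗ X ⊗ X') (Z ⊗ Y ⊗ Y') := castm (idm Z ⊠ f).

Lemma lw_o01 (X : D) (f : hom unit_ob X) Z : is_lw Z f (o01 f Z).
Proof. apply arr_sym, arr_castm. Qed.
Lemma lw_o10 (X : D) (f : hom X unit_ob) Z : is_lw Z f (o10 f Z).
Proof. apply arr_sym, arr_castm. Qed.
Lemma lw_o11 (X Y : D) (f : hom X Y) Z : is_lw Z f (o11 f Z).
Proof. apply arr_refl. Qed.
Lemma lw_o12 (X Y Y' : D) (f : hom X (Y ⊗ Y')) Z : is_lw Z f (o12 f Z).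
Proof. apply arr_sym, arr_castm. Qed.
Lemma lw_o21 (X X' Y : D) (f : hom (X ⊗ X') Y) Z : is_lw Z f (o21 f Z).
Proof. apply arr_sym, arr_castm. Qed.
Lemma lw_o22 (X X' Y Y' : D) (f : hom (X ⊗ X') (Y ⊗ Y')) Z : is_lw Z f (o22 f Z).
Proof. apply arr_sym, arr_castm. Qed.

(** The interchange law, with all four sides allowed to be rebracketed, so that it specializes to
    every pattern of source and target factors. *)
Lemma lw_nat (Z Z' X Y P Q P' Q' : D) (f : hom X Y) (t : hom Z Z')
    (F : hom P Q) (F' : hom P' Q') (s : hom P P') (s' : hom Q Q') :
  is_lw Z f F -> is_lw Z' f F' -> t ⊠ idm X ≡ s -> t ⊠ idm Y ≡ s' ->
  F' ∘ s = s' ∘ F.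
Proof.
unfold is_lw; intros eF eF' es es'; apply arr_eq_eq.
apply (arr_trans (arr_sym (arr_comp eF' es))).
apply (arr_trans (g := (t ⊠ idm Y) ∘ (idm Z ⊠ f))).
- rewrite <- !tens_comp, !comp_idl, !comp_idr; reflexivity.
- apply arr_comp; assumption.
Qed.

Lemma arr_tensrr (X Y V W : D) (f : hom X Y) :
  f ⊠ idm (V ⊗ W) ≡ f ⊠ idm V ⊠ idm W.
Proof. rewrite <- tens_id; apply tensmA. Qed.

Lemma o01_nat (X : D) (f : hom unit_ob X) Z Z' (t : hom Z Z') :
  o01 f Z' ∘ t = (t ⊠ idm X) ∘ o01 f Z.
Proof. eapply lw_nat; try apply lw_o01; [apply tensmf1 | reflexivity]. Qed.
Lemma o10_nat (X : D) (f : hom X unit_ob) Z Z' (t : hom Z Z') :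
  o10 f Z' ∘ (t ⊠ idm X) = t ∘ o10 f Z.
Proof. eapply lw_nat; try apply lw_o10; [reflexivity | apply tensmf1]. Qed.
Lemma o11_nat (X Y : D) (f : hom X Y) Z Z' (t : hom Z Z') :
  o11 f Z' ∘ (t ⊠ idm X) = (t ⊠ idm Y) ∘ o11 f Z.
Proof. eapply lw_nat; try apply lw_o11; reflexivity. Qed.
Lemma o12_nat (X Y Y' : D) (f : hom X (Y ⊗ Y')) Z Z' (t : hom Z Z') :
  o12 f Z' ∘ (t ⊠ idm X) = (t ⊠ idm Y ⊠ idm Y') ∘ o12 f Z.
Proof. eapply lw_nat; try apply lw_o12; [reflexivity | apply arr_tensrr]. Qed.
Lemma o21_nat (X X' Y : D) (f : hom (X ⊗ X') Y) Z Z' (t : hom Z Z') :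
  o21 f Z' ∘ (t ⊠ idm X ⊠ idm X') = (t ⊠ idm Y) ∘ o21 f Z.
Proof. eapply lw_nat; try apply lw_o21; [apply arr_tensrr | reflexivity]. Qed.
Lemma o22_nat (X X' Y Y' : D) (f : hom (X ⊗ X') (Y ⊗ Y')) Z Z' (t : hom Z Z') :
  o22 f Z' ∘ (t ⊠ idm X ⊠ idm X') = (t ⊠ idm Y ⊠ idm Y') ∘ o22 f Z.
Proof. eapply lw_nat; try apply lw_o22; apply arr_tensrr. Qed.

Lemma whisker (V X Y Y' Z : D) (g : hom Y Z) (f : hom X Y)
    (g' : hom Y' Z) (f' : hom X Y') :
  g ∘ f = g' ∘ f' ->
  (g ⊠ idm V) ∘ (f ⊠ idm V) = (g' ⊠ idm V) ∘ (f' ⊠ idm V).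
Proof. intros e; rewrite <- !tens_comp_idr, e; reflexivity. Qed.

Lemma precomp (X Y Y' Z W : D) (g : hom Y Z) (f : hom X Y)
    (g' : hom Y' Z) (f' : hom X Y') (x : hom Z W) :
  g ∘ f = g' ∘ f' -> x ∘ g ∘ f = x ∘ g' ∘ f'.
Proof. intros e; rewrite <- !compA, e; reflexivity. Qed.

End Families.

Notation "f ▹ X" := (f ⊠ idm X) (at level 40, left associativity) : cat_scope.

(** * Normal forms of composites and rewriting inside them *)

Ltac flat := rewrite ?tens_comp_idr, ?tens_id, ?compA, ?comp_idl, ?comp_idr.

(* [interchange g f] is a proof of g ∘ f = f' ∘ g' when f acts to the left of g. *)
Ltac interchange g f :=
  lazymatch g with
  | ?g1 ⊠ idm ?V =>
      lazymatch f with
      | ?f1 ⊠ idm V =>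
          let p := interchange g1 f1 in constr:(@whisker _ V _ _ _ _ _ _ _ _ p)
      end
  | o01 ?h _ => constr:(o01_nat h f)
  | o10 ?h _ => lazymatch f with ?t ⊠ idm _ => constr:(o10_nat h t) end
  | o11 ?h _ => lazymatch f with ?t ⊠ idm _ => constr:(o11_nat h t) end
  | o12 ?h _ => lazymatch f with ?t ⊠ idm _ => constr:(o12_nat h t) end
  | o21 ?h _ => lazymatch f with ?t ⊠ idm _ ⊠ idm _ => constr:(o21_nat h t) end
  | o22 ?h _ => lazymatch f with ?t ⊠ idm _ ⊠ idm _ => constr:(o22_nat h t) end
  end.

(* [interchange' f g] is a proof of f ∘ g = g' ∘ f' when f acts to the left of g. *)
Ltac interchange' f g :=
  lazymatch g with
  | ?g1 ⊠ idm ?V =>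
      lazymatch f with
      | ?f1 ⊠ idm V =>
          let p := interchange' f1 g1 in constr:(@whisker _ V _ _ _ _ _ _ _ _ p)
      end
  | o01 ?h _ => lazymatch f with ?t ⊠ idm _ => constr:(eq_sym (o01_nat h t)) end
  | o10 ?h _ => constr:(eq_sym (o10_nat h f))
  | o11 ?h _ => lazymatch f with ?t ⊠ idm _ => constr:(eq_sym (o11_nat h t)) end
  | o12 ?h _ =>
      lazymatch f with ?t ⊠ idm _ ⊠ idm _ => constr:(eq_sym (o12_nat h t)) end
  | o21 ?h _ => lazymatch f with ?t ⊠ idm _ => constr:(eq_sym (o21_nat h t)) end
  | o22 ?h _ =>
      lazymatch f with ?t ⊠ idm _ ⊠ idm _ => constr:(eq_sym (o22_nat h t)) end
  end.

(* [slide] moves the factors acting furthest to the right to the beginning of the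
   composite, [unslide] those acting furthest to the left. *)
Ltac slide1 :=
  match goal with
  | |- context [?x ∘ ?g ∘ ?f] =>
      let p := interchange g f in
      rewrite (@precomp _ _ _ _ _ _ _ _ _ _ x p)
  | |- context [?g ∘ ?f] => let p := interchange g f in rewrite p
  end.

Ltac slide := flat; repeat slide1; try reflexivity.

Ltac unslide1 :=
  match goal with
  | |- context [?x ∘ ?f ∘ ?g] =>
      let p := interchange' f g in
      rewrite (@precomp _ _ _ _ _ _ _ _ _ _ x p)
  | |- context [?f ∘ ?g] => let p := interchange' f g in rewrite p
  end.

Ltac unslide := flat; repeat unslide1; try reflexivity.

(* A proof that whiskering the composite t by V is computed factorwise. *)
Ltac whisk_pf V t :=
  lazymatch t with
  | idm ?X => constr:(tens_id X V)
  | ?g ∘ ?f =>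
      let p := whisk_pf V g in let q := whisk_pf V f in
      constr:(eq_trans (tens_comp_idr V g f) (f_equal2 comp p q))
  | _ => constr:(eq_refl (t ⊠ idm V))
  end.

(** Whiskers a quantified equation by an arbitrary object, distributing over composites on both
    sides so that the result can match a flattened goal. *)
Ltac whisk_eq D E :=
  lazymatch type of E with
  | forall z : ?A, _ =>
      let z := fresh in constr:(fun z : A => ltac:(let r := whisk_eq D constr:(E z) in exact r))
  | ?L = ?R =>
      let V := fresh in constr:(fun V : ob D =>
        ltac:(let p := whisk_pf V L in let q := whisk_pf V R in
              exact (eq_trans (eq_sym p)
                       (eq_trans (f_equal (fun h => h ⊠ idm V) E) q))))
  end.

(* A proof that x ∘ t can be reassociated to the left. *)
Ltac pre_pf x t :=
  lazymatch t with
  | idm _ => constr:(comp_idr x)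
  | ?g ∘ ?f =>
      let p := pre_pf x g in
      constr:(eq_trans (compA x g f) (f_equal (fun h => h ∘ f) p))
  | _ => constr:(eq_refl (x ∘ t))
  end.

Ltac pre_eq E :=
  lazymatch type of E with
  | forall z : ?A, _ =>
      let z := fresh in constr:(fun z : A => ltac:(let r := pre_eq constr:(E z) in exact r))
  | @eq (@hom ?C ?X ?Y) ?L ?R =>
      let W := fresh in let x := fresh in constr:(fun (W : ob C) (x : hom Y W) =>
        ltac:(let p := pre_pf x L in let q := pre_pf x R in
              exact (eq_trans (eq_sym p) (eq_trans (f_equal (comp x) E) q))))
  end.

Ltac sym_eq E :=
  lazymatch type of E with
  | forall z : ?A, _ =>
      let z := fresh in constr:(fun z : A => ltac:(let r := sym_eq constr:(E z) in exact r))
  | _ => constr:(eq_sym E)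
  end.

Ltac rw_base E :=
  first
  [ rewrite E
  | let p := pre_eq E in let H := fresh in
    pose proof p as H; cbv beta in H; rewrite H; clear H ].

(** [n] bounds how many times the equation is whiskered before giving up. *)
Ltac rw_whisk D n E :=
  first
  [ rw_base E
  | lazymatch n with
    | S ?m =>
        let p := whisk_eq D E in let H := fresh in
        pose proof p as H; cbv beta in H; rw_whisk D m H; clear H
    end ].

(* Rewriting with an equation between composites inside a longer composite,
   possibly whiskered on the right. *)
Ltac rw E :=
  lazymatch goal with
  | |- @eq (@hom ?D _ _) _ _ =>
      let H := fresh in
      pose proof E as H; cbv beta in H; rw_whisk D 4 H; clear H; flat
  end.

Ltac rwr E :=
  let H := fresh in let H' := fresh in
  pose proof E as H; cbv beta in H;
  let p := sym_eq H in pose proof p as H'; cbv beta in H'; rw H'; clear H H'.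

Lemma lw_fmap_ccomp (C D : strict_monoidal) (F : functor C D) (X Y Y1 V : C)
    (Z P Q R : D) (e : ob_eq Y Y1) (g : hom Y1 V) (f : hom X Y)
    (G : hom Q R) (F' : hom P Q) :
  is_lw Z (fmap F g) G -> is_lw Z (fmap F f) F' -> is_lw Z (fmap F (g ⊚ f)) (G ∘ F').
Proof.
unfold ob_eq in e; subst Y1; intros.
unfold ccomp; cbn; rewrite fmap_comp; apply lw_comp; assumption.
Qed.

Lemma lw_fmap_tens (C D : strict_monoidal) (F : strict_monoidal_functor C D)
    (X Y X' Y' : C) (Z P Q : D) (f : hom X Y) (g : hom X' Y') (G : hom P Q) :
  is_lw Z (fmap F f ⊠ fmap F g) G -> is_lw Z (fmap F (f ⊠ g)) G.
Proof. apply lw_change, smf_tensm. Qed.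

Lemma lw_tensr_smf (C D : strict_monoidal) (F : strict_monoidal_functor C D)
    (V W : C) (Z X Y P Q : D) (f : hom X Y) (G : hom P Q) :
  is_lw Z (f ⊠ idm (F V ⊗ F W)) G -> is_lw Z (f ⊠ idm (F (V ⊗ W))) G.
Proof. rewrite smf_tens; trivial. Qed.

Lemma lw_tensr_smf1 (C D : strict_monoidal) (F : strict_monoidal_functor C D)
    (Z X Y P Q : D) (f : hom X Y) (G : hom P Q) :
  is_lw Z f G -> is_lw Z (f ⊠ idm (F unit_ob)) G.
Proof. rewrite smf_unit; apply lw_tensr1. Qed.

(* Automatic computation of whiskered components *)
Create HintDb lw.

Ltac simpl_ob V :=
  eval cbn [coalg_ob coalgH bar_coalg bialg_coalg unit_coalg tens_coalg coalgHH
            alg_ob tens_alg bialg_alg coact_alg cleft_coact crossed_product] in V.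

(* [flat_ob Z V] is Z ⊗ V bracketed to the left. *)
Ltac flat_ob Z V :=
  let V' := simpl_ob V in
  lazymatch V' with
  | ?V1 ⊗ ?V2 => let Z1 := flat_ob Z V1 in flat_ob Z1 V2
  | unit_ob => Z
  | fob ?F (?V1 ⊗ ?V2) => flat_ob Z constr:(fob F V1 ⊗ fob F V2)
  | fob _ unit_ob => Z
  | _ => constr:(Z ⊗ V')
  end.

Ltac lw_leaf :=
  lazymatch goal with
  | |- @is_lw _ _ ?X0 ?Y0 _ _ _ _ =>
      let X := simpl_ob X0 in let Y := simpl_ob Y0 in
      lazymatch X with
      | _ ⊗ _ => lazymatch Y with
                 | _ ⊗ _ => apply lw_o22
                 | _ => apply lw_o21
                 end
      | unit_ob => apply lw_o01
      | _ => lazymatch Y with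
             | _ ⊗ _ => apply lw_o12
             | unit_ob => apply lw_o10
             | _ => apply lw_o11
             end
      end
  end.

(* Redefined below for the braiding. *)
Ltac lw_special := fail.

(* Computes F in is_lw Z f F by recursion on f. *)
Ltac lw :=
  lazymatch goal with
  | |- is_lw ?Z ?f _ =>
      lazymatch f with
      | castm _ => apply lw_castm; lw
      | conv _ _ => unfold conv; lw
      | fmap _ (_ ∘ _) => rewrite fmap_comp; lw
      | fmap _ (_ ⊚ _) => eapply lw_fmap_ccomp; lw
      | fmap _ (_ ⊠ _) => apply lw_fmap_tens; rewrite ?fmap_id; lw
      | fmap _ (idm _) => rewrite fmap_id; lw
      | _ ∘ _ => eapply lw_comp; lw
      | _ ⊚ _ => eapply lw_ccomp; lw
      | idm ?X => let W := flat_ob Z X in apply (@lw_id _ Z X W); strict_eq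
      | idm ?V ⊠ _ =>
          let W := flat_ob Z V in
          eapply (@lw_tensl _ Z _ _ V W); [strict_eq | lw]
      | _ ⊠ idm ?V =>
          let V' := simpl_ob V in
          lazymatch V' with
          | ?V1 ⊗ ?V2 => eapply (@lw_tensrr _ _ _ _ _ _ V1 V2); lw
          | unit_ob => eapply lw_tensr1; lw
          | fob _ (_ ⊗ _) => eapply lw_tensr_smf; lw
          | fob _ unit_ob => eapply lw_tensr_smf1; lw
          | _ => eapply (@lw_tensr _ _ _ _ _ _ V'); lw
          end
      | _ ⊠ _ => eapply lw_tens; lw
      | _ => first [lw_special | solve [eauto 2 with lw nocore] | lw_leaf]
      end
  end.

(* Deduces an equation of families at Z from an equation e between arrows. *)
Ltac lw_use e Z :=
  first [ refine (@lw_eq _ Z _ _ _ _ _ _ _ _ _ _ e _ _)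
        | refine (@lw_eq0 _ Z _ _ _ _ _ _ _ _ e _ _) ]; lw.
(* Computes the family of f, after t has unfolded the definition of f. *)
Tactic Notation "lw_compute" constr(f) "at" constr(Z) "by" tactic3(t) :=
  refine (@lw_eq _ Z _ _ _ _ _ _ _ _ _ _ (arr_refl f) _ _); [lw | t; lw].
Tactic Notation "lw_unfold" constr(f) "at" constr(Z) "as" reference(d) :=
  lw_compute f at Z by (unfold d).
Ltac lw_goal := eapply lw_arr; [lw | lw | ].

(** * Convolution invertibility as bijectivity of a linear and colinear map *)

Section ConvolutionInverse.
Context {M : strict_monoidal} (K : coalg_data M) (A : alg_data M).
Context (hK : is_coalgebra K) (hA : is_algebra A).

Definition conv_map (f : hom K A) : hom (A ⊗ K) (A ⊗ K) :=
  castm ((mul A ⊠ idm K) ⊚ (idm A ⊠ f ⊠ idm K) ⊚ (idm A ⊠ comul K)).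

Local Notation m := (o21 (mul A)).
Local Notation e := (o01 (unit A)).
Local Notation d := (o12 (comul K)).
Local Notation n := (o10 (counit K)).

Let mA Z : m Z ∘ m Z ▹ A = m Z ∘ m (Z ⊗ A).
Proof. lw_use (proj1 hA) Z. Qed.
Let em Z : m Z ∘ e Z ▹ A = idm (Z ⊗ A).
Proof. lw_use (proj1 (proj2 hA)) Z. Qed.
Let me Z : m Z ∘ e (Z ⊗ A) = idm (Z ⊗ A).
Proof. lw_use (proj2 (proj2 hA)) Z. Qed.
Let dA Z : d Z ▹ K ∘ d Z = d (Z ⊗ K) ∘ d Z.
Proof. lw_use (proj1 hK) Z. Qed.
Let nd Z : n Z ▹ K ∘ d Z = idm (Z ⊗ K).
Proof. lw_use (proj1 (proj2 hK)) Z. Qed.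
Let dn Z : n (Z ⊗ K) ∘ d Z = idm (Z ⊗ K).
Proof. lw_use (proj2 (proj2 hK)) Z. Qed.

Let phi (f : hom K A) Z := m Z ▹ K ∘ o11 f (Z ⊗ A) ▹ K ∘ d (Z ⊗ A).

Lemma lw_conv_map f Z : is_lw Z (conv_map f) (phi f Z).
Proof. unfold conv_map; lw. Qed.
#[local] Hint Resolve lw_conv_map : lw.

Let conv_lw f g (h : conv f g = unit A ∘ counit K) Z :
  m Z ∘ o11 f Z ▹ A ∘ o11 g (Z ⊗ K) ∘ d Z = e Z ∘ n Z.
Proof.
rewrite <- (compA _ _ (o11 g _)), <- o11_nat.
lw_use h Z.
Qed.

(** Composition of the attached maps is convolution in reverse order: a ⊗ c is sent to a f(c1) g(c2)
    ⊗ c3. *)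
Let phi_inv f g Z : conv f g = unit A ∘ counit K -> phi g Z ∘ phi f Z = idm (Z ⊗ A ⊗ K).
Proof.
intros h; unfold phi; flat.
slide. rwr dA. slide. rw mA. rw (conv_lw h). rw me. slide. rw nd. reflexivity.
Qed.

Let hom_conv_eq f g : (forall Z, m Z ∘ o11 f Z ▹ A ∘ o11 g (Z ⊗ K) ∘ d Z = e Z ∘ n Z) ->
  conv f g = unit A ∘ counit K.
Proof.
intros h; apply arr_eq_eq; lw_goal. rewrite <- (h unit_ob). slide.
Qed.

(** For the converse, the inverse of a linear and colinear bijection is again linear and colinear,
    hence comes from a morphism [K] to [A]. *)
Lemma conv_invertible_iso (f : hom K A) : conv_invertible f <-> is_iso (conv_map f).
Proof.
split.
- intros [g [fg gf]]; exists (conv_map g); split; apply arr_eq_eq; lw_goal;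
    apply phi_inv; assumption.
- intros [t [tf ft]].
  assert (PO : forall Z, phi f Z ∘ o22 t Z = idm (Z ⊗ A ⊗ K)).
  { intros Z; lw_use ft Z. }
  assert (OP : forall Z, o22 t Z ∘ phi f Z = idm (Z ⊗ A ⊗ K)).
  { intros Z; lw_use tf Z. }
  (* A map a ⊗ c |-> a g(c1) ⊗ c2 determines g by inserting 1 for a and applying the counit; the
     same recipe applied to [t] gives the candidate inverse, with [i] as its family. *)
  pose (i Z := n (Z ⊗ A) ∘ o22 t Z ∘ e Z ▹ K).
  pose (g := castm ((idm A ⊠ counit K) ⊚ t ⊚ (unit A ⊠ idm K)) : hom K A).
  assert (gi : forall Z, o11 g Z = i Z).
  { intros Z; unfold i; lw_unfold g at Z as g. }
  (* Conjugating by [t] transfers linearity from [phi f] to [t]; colinearity is transferred in the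
     same way. *)
  assert (lin : forall Z, o22 t Z ∘ m Z ▹ K = m Z ▹ K ∘ o22 t (Z ⊗ A)).
  { intros Z. rewrite <- (comp_idr (o22 t Z ∘ m Z ▹ K)), <- (PO (Z ⊗ A)), compA.
    rewrite <- (compA (o22 t Z) (m Z ▹ K)).
    replace (m Z ▹ K ∘ phi f (Z ⊗ A)) with (phi f Z ∘ m Z ▹ K).
    - rewrite compA, OP, comp_idl; reflexivity.
    - unfold phi; slide; rw mA; slide. }
  assert (colin : forall Z, o22 t Z ▹ K ∘ d (Z ⊗ A) = d (Z ⊗ A) ∘ o22 t Z).
  { intros Z. rewrite <- (comp_idr (o22 t Z ▹ K ∘ d (Z ⊗ A))), <- (PO Z), compA.
    rewrite <- (compA (o22 t Z ▹ K) (d (Z ⊗ A))).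
    replace (d (Z ⊗ A) ∘ phi f Z) with (phi f Z ▹ K ∘ d (Z ⊗ A)).
    - rewrite compA, <- tens_comp_idr, OP, tens_id, comp_idl; reflexivity.
    - unfold phi; slide; rwr dA; slide. }
  assert (fd : forall Z, phi f Z ∘ e Z ▹ K = o11 f Z ▹ K ∘ d Z).
  { intros Z; unfold phi; slide; rw em; reflexivity. }
  assert (nf : forall Z, n (Z ⊗ A) ∘ phi f Z = m Z ∘ o11 f (Z ⊗ A)).
  { intros Z; unfold phi; slide; rw dn; reflexivity. }
  exists g; split; apply hom_conv_eq; intros Z; rewrite gi; unfold i; flat.
  (* Linearity pulls f(c1) inside [t], where f(c1) ⊗ c2 is the image of 1 ⊗ c under [phi f]. *)
  + transitivity (n (Z ⊗ A) ∘ m Z ▹ K ∘ o22 t (Z ⊗ A) ∘ e (Z ⊗ A) ▹ K ∘ o11 f Z ▹ K ∘ d Z).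
    { slide. }
    rewrite <- (compA _ _ (o22 t _)), <- lin; flat; rw me.
    rw (eq_sym (fd Z)); rewrite <- (compA _ (o22 t Z)), OP; slide.
  (* Here colinearity moves the comultiplication behind [t], and the counit then leaves [n] after
     [phi f] after [t]. *)
  + transitivity (m Z ∘ o11 f (Z ⊗ A) ∘ n (Z ⊗ A) ▹ K ∘ o22 t Z ▹ K ∘ e Z ▹ K ▹ K ∘ d Z).
    { slide. }
    transitivity (m Z ∘ o11 f (Z ⊗ A) ∘ n (Z ⊗ A) ▹ K ∘ o22 t Z ▹ K ∘ d (Z ⊗ A) ∘ e Z ▹ K).
    { slide. }
    rw colin; rw nd; rewrite <- nf; rewrite <- (compA _ (phi f Z)), PO; slide.
Qed.

End ConvolutionInverse.

(** * The braiding and the Hopf algebra *)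

Lemma iso_idempotent (M : category) (X : M) (f : hom X X) :
  is_iso f -> f = f ∘ f -> f = idm X.
Proof.
intros [g [gf fg]] e.
rewrite <- gf; rewrite e at 2; rewrite compA, gf, comp_idl; reflexivity.
Qed.

Section BraidingFamilies.
Context {C D : strict_monoidal} {bar : strict_monoidal_functor C D}.
Context (c : left_braiding bar) (H : bialg_data C).

Local Notation K := (fob (smf_functor bar) (bialg_ob H)).
Local Notation mK := (o21 (mulH (bar:=bar) H)).
Local Notation eK := (o01 (unitH (bar:=bar) H)).
Local Notation dK := (o12 (comulH (bar:=bar) H)).
Local Notation nK := (o10 (counitH (bar:=bar) H)).
Local Notation b V := (o22 (braid c H V)).

Lemma lw_fmap_bmul (Z : D) : is_lw Z (fmap bar (bmul H)) (mK Z).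
Proof. eapply lw_change; [apply arr_sym, arr_castm | apply lw_o21]. Qed.
Lemma lw_fmap_bunit (Z : D) : is_lw Z (fmap bar (bunit H)) (eK Z).
Proof. eapply lw_change; [apply arr_sym, arr_castm | apply lw_o01]. Qed.
Lemma lw_fmap_bcomul (Z : D) : is_lw Z (fmap bar (bcomul H)) (dK Z).
Proof. eapply lw_change; [apply arr_sym, arr_castm | apply lw_o12]. Qed.
Lemma lw_fmap_bcounit (Z : D) : is_lw Z (fmap bar (bcounit H)) (nK Z).
Proof. eapply lw_change; [apply arr_sym, arr_castm | apply lw_o10]. Qed.

(** Writing the unit as its own tensor square, the braiding axiom makes this component idempotent;
    an invertible idempotent is the identity. The same argument works in the other variable. *)
Lemma braid_unitr (X : C) : c X unit_ob ≡ idm (bar X).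
Proof.
pose (p := castm (c X unit_ob) : hom (bar X) (bar X)).
assert (cp : c X unit_ob ≡ p) by apply arr_sym, arr_castm.
apply (arr_trans cp), (f_equal (@Arrow _ _ _)), iso_idempotent.
- exact (arr_iso cp (braid_iso c X unit_ob)).
- apply arr_eq_eq, (arr_trans (arr_sym cp)).
  assert (e : c X (unit_ob ⊗ unit_ob) ≡ c X unit_ob) by (rewrite tens1X; reflexivity).
  apply (arr_trans (arr_sym e)), (arr_trans (braid_tensr c _ _ _)), arr_ccomp.
  + exact (arr_trans (tensm1f _) cp).
  + exact (arr_trans (tensmf1 _) cp).
Qed.

Lemma braid_unitl (V : D) : c unit_ob V ≡ idm V.
Proof.
pose (p := castm (c unit_ob V) : hom V V).
assert (cp : c unit_ob V ≡ p) by apply arr_sym, arr_castm.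
apply (arr_trans cp), (f_equal (@Arrow _ _ _)), iso_idempotent.
- exact (arr_iso cp (braid_iso c unit_ob V)).
- apply arr_eq_eq, (arr_trans (arr_sym cp)).
  assert (e : c (unit_ob ⊗ unit_ob) V ≡ c unit_ob V) by (rewrite tens1X; reflexivity).
  apply (arr_trans (arr_sym e)), (arr_trans (braid_tensl c _ _ _)), arr_ccomp.
  + exact (arr_trans (arr_trans (arr_tens (arr_refl _) (arr_idm (smf_unit bar)))
                        (tensmf1 _)) cp).
  + exact (arr_trans (arr_trans (arr_tens (arr_idm (smf_unit bar)) (arr_refl _))
                        (tensm1f _)) cp).
Qed.

Lemma lw_braid_tensr (V W Z : D) :
  is_lw Z (c H (V ⊗ W)) (b W (Z ⊗ V) ∘ b V Z ▹ W).
Proof. eapply lw_change; [apply braid_tensr | lw]. Qed.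
Lemma lw_braid_tensl (V Z : D) :
  is_lw Z (c (bialg_ob H ⊗ bialg_ob H) V) (b V Z ▹ K ∘ b V (Z ⊗ K)).
Proof. eapply lw_change; [apply braid_tensl | lw]. Qed.
Lemma lw_braid_unitr (Z : D) : is_lw Z (c H unit_ob) (idm (Z ⊗ K)).
Proof. eapply lw_change; [apply braid_unitr | lw]. Qed.
Lemma lw_braid_unitl (V Z : D) : is_lw Z (c unit_ob V) (idm (Z ⊗ V)).
Proof. eapply lw_change; [apply braid_unitl | lw]. Qed.
End BraidingFamilies.

Ltac lw_special ::=
  lazymatch goal with
  | |- is_lw ?Z (braid ?c (bialg_ob ?H) ?V) _ =>
      let V' := simpl_ob V in
      lazymatch V' with
      | ?V1 ⊗ ?V2 => apply (lw_braid_tensr c H V1 V2 Z)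
      | unit_ob => apply (lw_braid_unitr c H Z)
      end
  | |- is_lw ?Z (braid ?c (bialg_ob ?H ⊗ bialg_ob ?H) ?V) _ =>
      apply (lw_braid_tensl c H V Z)
  | |- is_lw ?Z (braid ?c unit_ob ?V) _ => apply (lw_braid_unitl c V Z)
  | |- is_lw _ (fmap _ _) _ =>
      first [ apply lw_fmap_bmul | apply lw_fmap_bunit
            | apply lw_fmap_bcomul | apply lw_fmap_bcounit ]
  end.

Section HopfFamilies.
Context {C D : strict_monoidal} {bar : strict_monoidal_functor C D}.
Context (c : left_braiding bar) (H : bialg_data C).

Local Notation K := (fob (smf_functor bar) (bialg_ob H)).
Local Notation mK := (o21 (mulH (bar:=bar) H)).
Local Notation eK := (o01 (unitH (bar:=bar) H)).
Local Notation dK := (o12 (comulH (bar:=bar) H)).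
Local Notation nK := (o10 (counitH (bar:=bar) H)).
Local Notation b V := (o22 (braid c H V)).

(** The right factor is comultiplied first, which differs by one interchange from the order produced
    by the definition. *)
Definition comulHH_family (Z : D) : hom (Z ⊗ K ⊗ K) (Z ⊗ K ⊗ K ⊗ K ⊗ K) :=
  b K (Z ⊗ K) ▹ K ∘ dK Z ▹ K ▹ K ∘ dK (Z ⊗ K).

Lemma lw_comulHH (Z : D) : is_lw Z (comul (coalgHH c H)) (comulHH_family Z).
Proof.
unfold coalgHH, tens_coalg, comulHH_family; cbn [comul coalg_ob bialg_coalg].
rewrite <- (compA (b K _ ▹ K)), <- o12_nat.
lw.
Qed.

Lemma lw_counitHH (Z : D) : is_lw Z (counit (coalgHH c H)) (nK Z ∘ nK (Z ⊗ K)).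
Proof.
unfold coalgHH, tens_coalg; cbn [counit coalg_ob bialg_coalg].
rewrite <- o10_nat.
lw.
Qed.
#[local] Hint Resolve lw_comulHH lw_counitHH : lw.

Context (hH : is_hopf_algebra c H).

Let hB := proj1 hH.
Let hHa := proj1 hB.
Let hHc := proj1 (proj2 hB).
Let hHm := proj1 (proj2 (proj2 hB)).
Let hHu := proj2 (proj2 (proj2 hB)).

(** The algebra and coalgebra axioms of [H] live in the source category and are carried over by the
    strict monoidal functor; the bialgebra compatibilities below are stated in the target
    already. *)
Lemma mulH_assoc Z : mK Z ∘ mK Z ▹ K = mK Z ∘ mK (Z ⊗ K).
Proof. lw_use (arr_fmap bar (proj1 hHa)) Z. Qed.
Lemma mul_unitHl Z : mK Z ∘ eK Z ▹ K = idm (Z ⊗ K).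
Proof. lw_use (arr_fmap bar (proj1 (proj2 hHa))) Z. Qed.
Lemma mul_unitHr Z : mK Z ∘ eK (Z ⊗ K) = idm (Z ⊗ K).
Proof. lw_use (arr_fmap bar (proj2 (proj2 hHa))) Z. Qed.
Lemma comulH_assoc Z : dK Z ▹ K ∘ dK Z = dK (Z ⊗ K) ∘ dK Z.
Proof. lw_use (arr_fmap bar (proj1 hHc)) Z. Qed.
Lemma counit_comulHl Z : nK Z ▹ K ∘ dK Z = idm (Z ⊗ K).
Proof. lw_use (arr_fmap bar (proj1 (proj2 hHc))) Z. Qed.
Lemma counit_comulHr Z : nK (Z ⊗ K) ∘ dK Z = idm (Z ⊗ K).
Proof. lw_use (arr_fmap bar (proj2 (proj2 hHc))) Z. Qed.
Lemma comul_mulH Z : dK Z ∘ mK Z = mK Z ▹ K ∘ mK (Z ⊗ K ⊗ K) ∘ comulHH_family Z.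
Proof.
rewrite <- o21_nat. lw_use (proj1 hHm) Z.
Qed.
Lemma counit_mulH Z : nK Z ∘ mK Z = nK Z ∘ nK (Z ⊗ K).
Proof. lw_use (proj2 hHm) Z. Qed.
Lemma comul_unitH Z : dK Z ∘ eK Z = eK Z ▹ K ∘ eK Z.
Proof.
rewrite <- o01_nat, <- (comp_idr (eK _ ∘ eK Z)).
pose proof (proj1 hHu) as h; cbn [comul unit_coalg coalg_ob] in h; lw_use h Z.
Qed.
Lemma counit_unitH Z : nK Z ∘ eK Z = idm Z.
Proof.
pose proof (proj2 hHu) as h; cbn [counit unit_coalg coalg_ob] in h; lw_use h Z.
Qed.

Ltac braid_natr g Z :=
  let h := fresh in
  pose proof (braid_nat c (idm (bialg_ob H)) g) as h; rewrite !fmap_id in h;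
  lw_use h Z.
Lemma braid_nat01 (W : D) (g : hom unit_ob W) Z :
  b W Z ∘ o01 g (Z ⊗ K) = o01 g Z ▹ K.
Proof. rewrite <- (comp_idr (o01 g Z ▹ K)); braid_natr g Z. Qed.
Lemma braid_nat11 (V W : D) (g : hom V W) Z :
  b W Z ∘ o11 g (Z ⊗ K) = o11 g Z ▹ K ∘ b V Z.
Proof. braid_natr g Z. Qed.
Lemma braid_nat10 (V : D) (g : hom V unit_ob) Z :
  o10 g Z ▹ K ∘ b V Z = o10 g (Z ⊗ K).
Proof. rewrite <- (comp_idl (o10 g (Z ⊗ K))); symmetry; braid_natr g Z. Qed.
Lemma braid_nat12 (V W W' : D) (g : hom V (W ⊗ W')) Z :
  o12 g Z ▹ K ∘ b V Z = b W' (Z ⊗ W) ∘ b W Z ▹ W' ∘ o12 g (Z ⊗ K).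
Proof. symmetry; braid_natr g Z. Qed.
Lemma braid_nat21 (V V' W : D) (g : hom (V ⊗ V') W) Z :
  b W Z ∘ o21 g (Z ⊗ K) = o21 g Z ▹ K ∘ b V' (Z ⊗ V) ∘ b V Z ▹ V'.
Proof. rewrite <- compA; braid_natr g Z. Qed.
Lemma braid_nat22 (V V' W W' : D) (g : hom (V ⊗ V') (W ⊗ W')) Z :
  o22 g Z ▹ K ∘ b V' (Z ⊗ V) ∘ b V Z ▹ V' = b W' (Z ⊗ W) ∘ b W Z ▹ W' ∘ o22 g (Z ⊗ K).
Proof. symmetry; rewrite <- (compA (o22 g Z ▹ K)); braid_natr g Z. Qed.

Ltac braid_natl f V Z :=
  let h := fresh in
  pose proof (braid_nat c f (idm V)) as h;
  lw_use h Z.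
Lemma braid_mulH (V : D) Z : b V Z ∘ mK Z ▹ V = mK (Z ⊗ V) ∘ b V Z ▹ K ∘ b V (Z ⊗ K).
Proof. rewrite <- compA. braid_natl (bmul H) V Z. Qed.
Lemma braid_unitH (V : D) Z : b V Z ∘ eK Z ▹ V = eK (Z ⊗ V).
Proof. rewrite <- (comp_idr (eK (Z ⊗ V))); braid_natl (bunit H) V Z. Qed.
Lemma braid_comulH (V : D) Z : dK (Z ⊗ V) ∘ b V Z = b V Z ▹ K ∘ b V (Z ⊗ K) ∘ dK Z ▹ V.
Proof. symmetry; braid_natl (bcomul H) V Z. Qed.
Lemma braid_counitH (V : D) Z : nK (Z ⊗ V) ∘ b V Z = nK Z ▹ V.
Proof. rewrite <- (comp_idl (nK Z ▹ V)); symmetry; braid_natl (bcounit H) V Z. Qed.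
End HopfFamilies.

#[export] Hint Resolve lw_comulHH lw_counitHH : lw.

(** * Colinear maps *)

Section Colinear.
Context {C D : strict_monoidal} {bar : strict_monoidal_functor C D}.
Context (c : left_braiding bar) (H : bialg_data C) (hH : is_hopf_algebra c H).

Local Notation K := (fob (smf_functor bar) (bialg_ob H)).
Local Notation mK := (o21 (mulH (bar:=bar) H)).
Local Notation eK := (o01 (unitH (bar:=bar) H)).
Local Notation dK := (o12 (comulH (bar:=bar) H)).
Local Notation nK := (o10 (counitH (bar:=bar) H)).
Local Notation b V := (o22 (braid c H V)).

(* The diagonal coactions on X ⊗ V, with V carrying the trivial coaction, and on X ⊗ K.
*)
Definition coact_tens (V X : D) (r : hom X (X ⊗ K)) : hom (X ⊗ V) (X ⊗ V ⊗ K) :=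
  b V X ∘ r ▹ V.
Definition coact_tensK (X : D) (r : hom X (X ⊗ K)) : hom (X ⊗ K) (X ⊗ K ⊗ K) :=
  mK (X ⊗ K) ∘ b K X ▹ K ∘ r ▹ K ▹ K ∘ dK X.

Definition colinear (X Y : D) (r : hom X (X ⊗ K)) (r' : hom Y (Y ⊗ K)) (f : hom X Y) :=
  r' ∘ f = f ▹ K ∘ r.

Lemma colinear_comp X Y Z (rX : hom X (X ⊗ K)) (rY : hom Y (Y ⊗ K)) (rZ : hom Z (Z ⊗ K))
    (g : hom Y Z) (f : hom X Y) :
  colinear rY rZ g -> colinear rX rY f -> colinear rX rZ (g ∘ f).
Proof.
unfold colinear; intros eg ef; rewrite compA, eg, <- compA, ef, tens_comp_idr, compA.
reflexivity.
Qed.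

Lemma colinear_tens X Y (r : hom X (X ⊗ K)) (r' : hom Y (Y ⊗ K)) (f : hom X Y) V :
  colinear r r' f -> colinear (coact_tens V r) (coact_tens V r') (f ▹ V).
Proof.
unfold colinear, coact_tens; intros e.
rw e. slide.
Qed.

Lemma colinear_tensK X Y (r : hom X (X ⊗ K)) (r' : hom Y (Y ⊗ K)) (f : hom X Y) :
  colinear r r' f -> colinear (coact_tensK r) (coact_tensK r') (f ▹ K).
Proof.
unfold colinear, coact_tensK; intros e.
slide. rw e. slide.
Qed.

(** The factors [V], [V'] and [W] carry trivial coactions, so colinearity is naturality of the
    braiding in them. *)
Lemma colinear21 X (r : hom X (X ⊗ K)) V V' W (g : hom (V ⊗ V') W) :
  colinear (coact_tens V' (coact_tens V r)) (coact_tens W r) (o21 g X).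
Proof. unfold colinear, coact_tens. rwr (o21_nat g). rw (braid_nat21 c H). reflexivity.
Qed.

Context (A : cocycle_data (bar:=bar) H).
Local Notation v := (o21 (act A)).
Local Notation s := (o21 (coc A)).
Local Notation T := (o22 (cnu c A)).
Local Notation S := (o22 (coc_hat c A)).

Lemma cnuE Z : T Z = v Z ▹ K ∘ b A (Z ⊗ K) ∘ dK Z ▹ A.
Proof. lw_unfold (cnu c A) at Z as cnu. Qed.
Lemma coc_hatE Z : S Z = s Z ▹ K ∘ mK (Z ⊗ K ⊗ K) ∘ comulHH_family c H Z.
Proof. rewrite <- o21_nat. lw_unfold (coc_hat c A) at Z as coc_hat. Qed.

(** Both sides send x ⊗ h ⊗ a to x0 ⊗ h1·a ⊗ h2 ⊗ x1 h3, up to braidings. *)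
Lemma colinear_cnu X (r : hom X (X ⊗ K)) :
  colinear (coact_tens A (coact_tensK r)) (coact_tensK (coact_tens A r)) (T X).
Proof.
unfold colinear, coact_tens, coact_tensK.
rewrite !cnuE.
slide.
rw (braid_comulH c H). slide.
rw (braid_mulH c H). slide.
rwr (o21_nat (act A)). rw (braid_nat21 c H). slide.
rwr (comulH_assoc hH). unslide.
rw (braid_nat12 c H). unslide.
(* Naturality of the braiding with respect to the braiding itself, that is, the braid relation. *)
rw (o22_nat (braid c H K)). rwr (braid_nat22 c H (braid c H A)). slide.
Qed.

(** Both sides send x ⊗ h ⊗ l to x0 ⊗ σ(h1 ⊗ l1) ⊗ h2 l2 ⊗ x1 h3 l3, up to braidings; the point is
    that the comultiplication of [H] is multiplicative. *)
Lemma colinear_coc_hat X (r : hom X (X ⊗ K)) :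
  colinear (coact_tensK (coact_tensK r)) (coact_tensK (coact_tens A r)) (S X).
Proof.
unfold colinear, coact_tens, coact_tensK.
rewrite !coc_hatE; unfold comulHH_family.
slide. rw (comul_mulH hH); unfold comulHH_family. slide.
rwr (o21_nat (coc A)). rw (braid_nat21 c H). slide.
repeat (first [rw (braid_comulH c H) | rw (braid_mulH c H)]; slide).
unslide.
do 2 (rw (braid_nat12 c H); unslide).
rw (braid_nat21 c H (mulH (bar:=bar) H)); unslide.
rwr (mulH_assoc hH). unslide.
slide. unslide.
rw (braid_nat12 c H).
do 2 rw (comulH_assoc hH). unslide.
rw (o22_nat (braid c H K) (s X)). rwr (braid_nat22 c H (braid c H K)). slide.
Qed.
End Colinear.

(** * Crossed products *)

Section CrossedProduct.
Context {C D : strict_monoidal} {bar : strict_monoidal_functor C D}.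
Context (c : left_braiding bar) (H : bialg_data C) (hH : is_hopf_algebra c H).

Local Notation K := (fob (smf_functor bar) (bialg_ob H)).
Local Notation mK := (o21 (mulH (bar:=bar) H)).
Local Notation eK := (o01 (unitH (bar:=bar) H)).
Local Notation dK := (o12 (comulH (bar:=bar) H)).
Local Notation nK := (o10 (counitH (bar:=bar) H)).
Local Notation b V := (o22 (braid c H V)).

(** [eK Z] is the trivial coaction z |-> z ⊗ 1. Tensored with a trivial factor it stays trivial;
    tensored with [K] it becomes the cofree coaction, which is the next lemma. *)
Lemma coact_tens_unit V Z : coact_tens c V (eK Z) = eK (Z ⊗ V).
Proof. unfold coact_tens; rw (braid_unitH c H); reflexivity. Qed.

Lemma coact_tensK_unit Z : coact_tensK c (eK Z) = dK Z.
Proof. unfold coact_tensK; rw (braid_unitH c H); rw (mul_unitHl hH); reflexivity. Qed.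

(* Y ⊗ K is cofree, so a colinear map into it is determined by its composite with
   the counit. *)
Lemma colinear_ext X Y (r : hom X (X ⊗ K)) (f g : hom X (Y ⊗ K)) :
  colinear r (coact_tensK c (eK Y)) f -> colinear r (coact_tensK c (eK Y)) g ->
  nK Y ∘ f = nK Y ∘ g -> f = g.
Proof.
rewrite coact_tensK_unit; unfold colinear; intros hf hg e.
rewrite <- (comp_idl f), <- (comp_idl g), <- (counit_comulHl hH), <- !compA, hf, hg, !compA.
rewrite <- !tens_comp_idr, e; reflexivity.
Qed.

Context (A : cocycle_data (bar:=bar) H) (hA : is_measuring_cocycle c A).
Local Notation mA := (o21 (mul A)).
Local Notation eA := (o01 (unit A)).
Local Notation v := (o21 (act A)).
Local Notation s := (o21 (coc A)).
Local Notation T := (o22 (cnu c A)).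
Local Notation S := (o22 (coc_hat c A)).

Let hA0 : is_measuring c A := proj1 hA.
Let hA1 : is_cocycle c A := proj2 hA.

Lemma meas_mulA Z : mA Z ∘ mA Z ▹ A = mA Z ∘ mA (Z ⊗ A).
Proof. lw_use (proj1 (proj1 hA0)) Z. Qed.
Lemma meas_mul1l Z : mA Z ∘ eA Z ▹ A = idm (Z ⊗ A).
Proof. lw_use (proj1 (proj2 (proj1 hA0))) Z. Qed.
Lemma meas_mul1r Z : mA Z ∘ eA (Z ⊗ A) = idm (Z ⊗ A).
Proof. lw_use (proj2 (proj2 (proj1 hA0))) Z. Qed.
Lemma act_unitH Z : v Z ∘ eK Z ▹ A = idm (Z ⊗ A).
Proof. lw_use (proj1 (proj2 hA0)) Z. Qed.
Lemma act_unit Z : v Z ∘ eA (Z ⊗ K) = eA Z ∘ nK Z.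
Proof. lw_use (proj1 (proj2 (proj2 hA0))) Z. Qed.
Lemma act_mul Z : v Z ∘ mA (Z ⊗ K) = mA Z ∘ v (Z ⊗ A) ∘ T Z ▹ A.
Proof.
transitivity (mA Z ∘ (v (Z ⊗ A) ∘ v Z ▹ K ▹ A) ∘ b A (Z ⊗ K) ▹ A ∘ dK Z ▹ A ▹ A).
- lw_use (proj2 (proj2 (proj2 hA0))) Z.
- rewrite cnuE; slide.
Qed.
Lemma cocycle_cond Z :
  mA Z ∘ s (Z ⊗ A) ∘ S Z ▹ K = mA Z ∘ s (Z ⊗ A) ∘ T Z ▹ K ∘ S (Z ⊗ K).
Proof. lw_use (proj1 (proj2 hA1)) Z. Qed.
Lemma twisted_module_cond Z :
  mA Z ∘ v (Z ⊗ A) ∘ S Z ▹ A = mA Z ∘ s (Z ⊗ A) ∘ T Z ▹ K ∘ T (Z ⊗ K).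
Proof. lw_use (proj1 (proj2 (proj2 hA1))) Z. Qed.
Lemma coc_unit2 Z : s Z ∘ eK Z ▹ K ∘ eK Z = eA Z.
Proof.
transitivity (s Z ∘ (eK (Z ⊗ K) ∘ eK Z)); [slide|].
lw_use (proj2 (proj2 (proj2 hA1))) Z.
Qed.

Lemma counit_cnu Z : nK (Z ⊗ A) ∘ T Z = v Z.
Proof. rewrite cnuE; slide. rw (braid_counitH c H). rw (counit_comulHr hH). reflexivity.
Qed.
Lemma counit_coc_hat Z : nK (Z ⊗ A) ∘ S Z = s Z.
Proof.
rewrite coc_hatE; unfold comulHH_family. slide. rw (counit_mulH hH). slide.
rw (counit_comulHr hH). rw (braid_counitH c H).
slide. rw (counit_comulHr hH). reflexivity.
Qed.

(** Lift of the measuring axiom: both sides are colinear into a cofree comodule, and their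
    composites with the counit agree by [act_mul]. The two cocycle conditions are lifted by the same
    method below. *)
Lemma cnu_mul Z : T Z ∘ mA (Z ⊗ K) = mA Z ▹ K ∘ T (Z ⊗ A) ∘ T Z ▹ A.
Proof.
apply (colinear_ext (r := coact_tens c A (coact_tens c A (coact_tensK c (eK Z))))).
- eapply colinear_comp; [|apply colinear21].
  rewrite <- (coact_tens_unit A). apply (colinear_cnu hH).
- rewrite <- (coact_tens_unit A).
  eapply colinear_comp; [|apply colinear_tens, (colinear_cnu hH)].
  eapply colinear_comp; [|apply (colinear_cnu hH)].
  apply colinear_tensK, colinear21.
- slide. do 2 rw counit_cnu. rw act_mul. reflexivity.
Qed.

Lemma coc_hat_cocycle Z :
  mA Z ▹ K ∘ S (Z ⊗ A) ∘ S Z ▹ K = mA Z ▹ K ∘ S (Z ⊗ A) ∘ T Z ▹ K ∘ S (Z ⊗ K).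
Proof.
apply (colinear_ext (r := coact_tensK c (coact_tensK c (coact_tensK c (eK Z)))));
  rewrite <- ?(coact_tens_unit A).
- eapply colinear_comp; [|apply colinear_tensK, (colinear_coc_hat hH)].
  eapply colinear_comp; [|apply (colinear_coc_hat hH)].
  apply colinear_tensK, colinear21.
- eapply colinear_comp; [|apply (colinear_coc_hat hH)].
  eapply colinear_comp; [|apply colinear_tensK, (colinear_cnu hH)].
  eapply colinear_comp; [|apply (colinear_coc_hat hH)].
  apply colinear_tensK, colinear21.
- slide. repeat rw counit_coc_hat. rw cocycle_cond. reflexivity.
Qed.

Lemma coc_hat_twisted Z :
  mA Z ▹ K ∘ T (Z ⊗ A) ∘ S Z ▹ A = mA Z ▹ K ∘ S (Z ⊗ A) ∘ T Z ▹ K ∘ T (Z ⊗ K).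
Proof.
apply (colinear_ext (r := coact_tens c A (coact_tensK c (coact_tensK c (eK Z)))));
  rewrite <- ?(coact_tens_unit A).
- eapply colinear_comp; [|apply colinear_tens, (colinear_coc_hat hH)].
  eapply colinear_comp; [|apply (colinear_cnu hH)].
  apply colinear_tensK, colinear21.
- eapply colinear_comp; [|apply (colinear_cnu hH)].
  eapply colinear_comp; [|apply colinear_tensK, (colinear_cnu hH)].
  eapply colinear_comp; [|apply (colinear_coc_hat hH)].
  apply colinear_tensK, colinear21.
- slide. rw counit_cnu. rw counit_coc_hat. rw twisted_module_cond. reflexivity.
Qed.

(** * Behaviour of T, S and σ on units *)

Lemma cnu_unitH Z : T Z ∘ eK Z ▹ A = eK (Z ⊗ A).
Proof.
rewrite cnuE. flat. rw (comul_unitH hH). rw (o22_nat (braid c H A)).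
rw (braid_unitH c H). rw act_unitH. reflexivity.
Qed.

Lemma cnu_unit Z : T Z ∘ eA (Z ⊗ K) = eA Z ▹ K.
Proof.
rewrite cnuE; unslide. rw (braid_nat01 c H). rw act_unit. rw (counit_comulHl hH).
reflexivity.
Qed.

Lemma coc_hat_unitl_coc Z : S Z ∘ eK Z ▹ K = s Z ▹ K ∘ eK Z ▹ K ▹ K ∘ dK Z.
Proof.
rewrite coc_hatE; unfold comulHH_family; slide. rw (comul_unitH hH).
rwr (o01_nat (unitH (bar:=bar) H) (eK Z)). rw (braid_unitH c H). rw (mul_unitHl hH).
slide.
Qed.

Lemma coc_hat_unitr_coc Z : S Z ∘ eK (Z ⊗ K) = s Z ▹ K ∘ eK (Z ⊗ K) ▹ K ∘ dK Z.
Proof.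
rewrite coc_hatE; unfold comulHH_family; flat. rw (comul_unitH hH). slide.
rwr (o01_nat (unitH (bar:=bar) H) (dK Z)). rw (braid_nat01 c H).
rwr (o01_nat (unitH (bar:=bar) H) (dK Z)).
rwr (o01_nat (unitH (bar:=bar) H) (eK (Z ⊗ K) ▹ K)).
rw (mul_unitHr hH). reflexivity.
Qed.

Lemma coc_hat_unit2 Z : S Z ∘ eK Z ▹ K ∘ eK Z = eA Z ▹ K ∘ eK Z.
Proof. rw coc_hat_unitl_coc. rw (comul_unitH hH). rw coc_unit2. reflexivity. Qed.

Let coc_inv : exists s', is_conv_inverse (K := coalgHH c H) (A := A) (coc A) s' :=
  proj1 hA1.

(** A convolution idempotent u with left inverse w is trivial: u = w * u * u = w * u = 1. *)
Lemma conv_idempotent (u w : hom K A) :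
  (forall Z, mA Z ∘ o11 u Z ▹ A ∘ o11 u (Z ⊗ K) ∘ dK Z = o11 u Z) ->
  (forall Z, mA Z ∘ o11 w Z ▹ A ∘ o11 u (Z ⊗ K) ∘ dK Z = eA Z ∘ nK Z) ->
  forall Z, o11 u Z = eA Z ∘ nK Z.
Proof.
intros uu wu Z.
transitivity (mA Z ∘ eA Z ▹ A ∘ nK Z ▹ A ∘ o11 u (Z ⊗ K) ∘ dK Z).
{ rw meas_mul1l. unslide. rw (counit_comulHl hH). reflexivity. }
rwr wu. rwr wu. slide. rw meas_mulA. rwr (o11_nat u (dK Z)). rw (comulH_assoc hH).
transitivity (mA Z ∘ o11 w Z ▹ A ∘ mA (Z ⊗ K) ∘ o11 u (Z ⊗ K) ▹ A ∘ o11 u (Z ⊗ K ⊗ K) ∘ dK (Z ⊗ K) ∘ dK Z).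
{ slide. }
rw uu. reflexivity.
Qed.

(** The cocycle condition at 1 ⊗ 1 ⊗ h together with σ(1 ⊗ 1) = 1 shows that u = σ(1 ⊗ -) is a
    convolution idempotent; restricting the inverse of σ along 1 ⊗ - gives a left inverse of u. *)
Lemma coc_unitl Z : s Z ∘ eK Z ▹ K = eA Z ∘ nK Z.
Proof.
destruct coc_inv as [s' [_ s's]].
pose (u := castm (coc A ⊚ (unitH (bar:=bar) H ⊠ idm K)) : hom K A).
pose (w := castm (s' ⊚ (unitH (bar:=bar) H ⊠ idm K)) : hom K A).
assert (uE : forall Y, o11 u Y = s Y ∘ eK Y ▹ K) by
  (intros Y; lw_unfold u at Y as u).
assert (wE : forall Y, o11 w Y = o21 s' Y ∘ eK Y ▹ K) by
  (intros Y; lw_unfold w at Y as w).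
rewrite <- uE; revert Z; apply (conv_idempotent (w := w)); intros Z.
- rewrite !uE.
  transitivity (mA Z ∘ s (Z ⊗ A) ∘ T Z ▹ K ∘ S (Z ⊗ K) ∘ eK Z ▹ K ▹ K ∘ eK Z ▹ K).
  + slide. rw cnu_unitH. rw coc_hat_unitl_coc. slide.
  + rwr cocycle_cond. rw coc_hat_unit2. slide. rw meas_mul1l. reflexivity.
- rewrite uE, wE.
  assert (h : forall Y, mA Y ∘ o21 s' Y ▹ A ∘ s (Y ⊗ K ⊗ K) ∘ comulHH_family c H Y =
                        eA Y ∘ (nK Y ∘ nK (Y ⊗ K))).
  { intros Y.
    transitivity (mA Y ∘ (s (Y ⊗ A) ∘ o21 s' Y ▹ K ▹ K) ∘ comulHH_family c H Y);
      [slide|].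
    lw_use s's Y. }
  transitivity (eA Z ∘ (nK Z ∘ nK (Z ⊗ K)) ∘ eK Z ▹ K).
  + rewrite <- h; unfold comulHH_family; slide. rw (comul_unitH hH).
    rwr (o01_nat (unitH (bar:=bar) H) (eK Z)). rw (braid_unitH c H). slide.
  + slide. rw (counit_unitH hH). reflexivity.
Qed.

(** As for the left unit, now with the cocycle condition at h ⊗ 1 ⊗ 1. *)
Lemma coc_unitr Z : s Z ∘ eK (Z ⊗ K) = eA Z ∘ nK Z.
Proof.
destruct coc_inv as [s' [_ s's]].
pose (u := castm (coc A ⊚ (idm K ⊠ unitH (bar:=bar) H)) : hom K A).
pose (w := castm (s' ⊚ (idm K ⊠ unitH (bar:=bar) H)) : hom K A).
assert (uE : forall Y, o11 u Y = s Y ∘ eK (Y ⊗ K)) by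
  (intros Y; lw_unfold u at Y as u).
assert (wE : forall Y, o11 w Y = o21 s' Y ∘ eK (Y ⊗ K)) by
  (intros Y; lw_unfold w at Y as w).
rewrite <- uE; revert Z; apply (conv_idempotent (w := w)); intros Z.
- rewrite !uE.
  transitivity (mA Z ∘ s (Z ⊗ A) ∘ S Z ▹ K ∘ eK (Z ⊗ K ⊗ K) ∘ eK (Z ⊗ K)).
  + transitivity (mA Z ∘ s (Z ⊗ A) ∘ eK (Z ⊗ A ⊗ K) ∘ (S Z ∘ eK (Z ⊗ K))).
    * rewrite coc_hat_unitr_coc. slide.
    * slide.
  + rw cocycle_cond. rw (o01_nat (unitH (bar:=bar) H) (eK (Z ⊗ K))). rw coc_hat_unit2.
    rw cnu_unit.
    slide. rw meas_mul1l. reflexivity.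
- rewrite uE, wE.
  assert (h : forall Y, mA Y ∘ o21 s' Y ▹ A ∘ s (Y ⊗ K ⊗ K) ∘ comulHH_family c H Y =
                        eA Y ∘ (nK Y ∘ nK (Y ⊗ K))).
  { intros Y.
    transitivity (mA Y ∘ (s (Y ⊗ A) ∘ o21 s' Y ▹ K ▹ K) ∘ comulHH_family c H Y);
      [slide|].
    lw_use s's Y. }
  transitivity (eA Z ∘ (nK Z ∘ nK (Z ⊗ K)) ∘ eK (Z ⊗ K)).
  + rewrite <- h; unfold comulHH_family; slide.
    rw (comul_unitH hH). do 2 rwr (o01_nat (unitH (bar:=bar) H) (dK Z)).
    rw (braid_nat01 c H). slide.
  + slide. rw (counit_unitH hH). reflexivity.
Qed.

Lemma coc_hat_unitl Z : S Z ∘ eK Z ▹ K = eA Z ▹ K.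
Proof. rw coc_hat_unitl_coc. rw coc_unitl. rw (counit_comulHl hH). reflexivity. Qed.
Lemma coc_hat_unitr Z : S Z ∘ eK (Z ⊗ K) = eA Z ▹ K.
Proof. rw coc_hat_unitr_coc. rw coc_unitr. rw (counit_comulHl hH). reflexivity. Qed.

(** The product a (h1·b) σ(h2 ⊗ l1) ⊗ h3 l2, with both multiplications of [A] postponed to the
    end. *)
Definition crossed_mul_family Z : hom (Z ⊗ A ⊗ K ⊗ A ⊗ K) (Z ⊗ A ⊗ K) :=
  mA Z ▹ K ∘ mA Z ▹ A ▹ K ∘ S (Z ⊗ A ⊗ A) ∘ T (Z ⊗ A) ▹ K.

(** Starting from (xy)z, the twisted module identity exchanges T after S, the cocycle identity
    reassociates the two S, and [cnu_mul] matches the three remaining T with T applied to the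
    product coming from yz. Associativity of [A] does the bookkeeping in between. *)
Lemma crossed_mul_assoc Z :
  crossed_mul_family Z ∘ crossed_mul_family Z ▹ A ▹ K = crossed_mul_family Z ∘ crossed_mul_family (Z ⊗ A ⊗ K).
Proof.
unfold crossed_mul_family.
transitivity (mA Z ▹ K ∘ mA Z ▹ A ▹ K ∘ mA Z ▹ A ▹ A ▹ K ∘ S (Z ⊗ A ⊗ A ⊗ A)
  ∘ mA (Z ⊗ A ⊗ A) ▹ K ▹ K ∘ T (Z ⊗ A ⊗ A ⊗ A) ▹ K ∘ S (Z ⊗ A ⊗ A) ▹ A ▹ K
  ∘ T (Z ⊗ A) ▹ K ▹ A ▹ K).
{ slide. repeat (rw meas_mulA; slide). }
transitivity (mA Z ▹ K ∘ mA Z ▹ A ▹ K ∘ mA Z ▹ A ▹ A ▹ K ∘ S (Z ⊗ A ⊗ A ⊗ A)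
  ∘ mA (Z ⊗ A ⊗ A) ▹ K ▹ K ∘ S (Z ⊗ A ⊗ A ⊗ A) ▹ K ∘ T (Z ⊗ A ⊗ A) ▹ K ▹ K
  ∘ T (Z ⊗ A ⊗ A ⊗ K) ▹ K ∘ T (Z ⊗ A) ▹ K ▹ A ▹ K).
{ rw coc_hat_twisted. reflexivity. }
transitivity (mA Z ▹ K ∘ mA Z ▹ A ▹ K ∘ mA Z ▹ A ▹ A ▹ K ∘ mA (Z ⊗ A ⊗ A ⊗ A) ▹ K
  ∘ S (Z ⊗ A ⊗ A ⊗ A ⊗ A) ∘ S (Z ⊗ A ⊗ A ⊗ A) ▹ K ∘ T (Z ⊗ A ⊗ A) ▹ K ▹ K
  ∘ T (Z ⊗ A ⊗ A ⊗ K) ▹ K ∘ T (Z ⊗ A) ▹ K ▹ A ▹ K).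
{ slide. repeat (rw meas_mulA; slide). }
rw coc_hat_cocycle.
transitivity (mA Z ▹ K ∘ mA Z ▹ A ▹ K ∘ S (Z ⊗ A ⊗ A) ∘ mA (Z ⊗ A) ▹ K ▹ K
  ∘ mA (Z ⊗ A) ▹ A ▹ K ▹ K ∘ T (Z ⊗ A ⊗ A ⊗ A) ▹ K ∘ T (Z ⊗ A ⊗ A) ▹ A ▹ K
  ∘ T (Z ⊗ A) ▹ A ▹ A ▹ K ∘ S (Z ⊗ A ⊗ K ⊗ A ⊗ A) ∘ T (Z ⊗ A ⊗ K ⊗ A) ▹ K).
{ slide. repeat (rw meas_mulA; slide). }
repeat (rw cnu_mul; slide).
Qed.

Lemma crossed_mul_e Z :
  crossed_mul_family Z ∘ eK (Z ⊗ A ⊗ K ⊗ A) ∘ eA (Z ⊗ A ⊗ K) = idm (Z ⊗ A ⊗ K).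
Proof.
unfold crossed_mul_family.
rwr (o01_nat (unitH (bar:=bar) H) (T (Z ⊗ A))). rw coc_hat_unitr.
rwr (o01_nat (unit A) (mA Z)). rw meas_mul1r. rw cnu_unit. rw meas_mul1r. reflexivity.
Qed.

Lemma crossed_e_mul Z :
  crossed_mul_family Z ∘ eK (Z ⊗ A) ▹ A ▹ K ∘ eA Z ▹ A ▹ K = idm (Z ⊗ A ⊗ K).
Proof.
unfold crossed_mul_family.
rw cnu_unitH. rw coc_hat_unitl. rwr (o01_nat (unit A) (mA Z)). rw meas_mul1r.
rw meas_mul1l. reflexivity.
Qed.

Lemma crossed_colinear Z (r : hom Z (Z ⊗ K)) :
  colinear (coact_tensK c (coact_tens c A (coact_tensK c (coact_tens c A r))))
    (coact_tensK c (coact_tens c A r)) (crossed_mul_family Z).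
Proof.
unfold crossed_mul_family.
eapply colinear_comp; [|apply colinear_tensK, (colinear_cnu hH)].
eapply colinear_comp; [|apply (colinear_coc_hat hH)].
eapply colinear_comp; [|apply colinear_tensK, colinear_tens, colinear21].
apply colinear_tensK, colinear21.
Qed.

End CrossedProduct.

(** * Composition and cancellation of isomorphisms *)

Lemma is_iso_comp (M : category) (X Y Z : M) (g : hom Y Z) (f : hom X Y) :
  is_iso g -> is_iso f -> is_iso (g ∘ f).
Proof.
intros [g' [g'g gg']] [f' [f'f ff']]; exists (f' ∘ g'); split.
- rewrite compA, <- (compA f'), g'g, comp_idr; exact f'f.
- rewrite compA, <- (compA g), ff', comp_idr; exact gg'.
Qed.

Lemma is_iso_ccomp (M : category) (X Y Y1 Z : M) (e : ob_eq Y Y1)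
    (g : hom Y1 Z) (f : hom X Y) : is_iso g -> is_iso f -> is_iso (g ⊚ f).
Proof. unfold ob_eq in e; subst Y1; apply is_iso_comp. Qed.

Lemma is_iso_cancell (M : category) (X Y Z : M) (g : hom Y Z) (f : hom X Y) :
  is_iso g -> is_iso (g ∘ f) -> is_iso f.
Proof.
intros [g' [g'g gg']] h.
replace f with (g' ∘ (g ∘ f)) by (rewrite compA, g'g, comp_idl; reflexivity).
apply is_iso_comp; [exists g; split|]; assumption.
Qed.

Lemma is_iso_ccancell (M : category) (X Y Y1 Z : M) (e : ob_eq Y Y1)
    (g : hom Y1 Z) (f : hom X Y) : is_iso g -> is_iso (g ⊚ f) -> is_iso f.
Proof. unfold ob_eq in e; subst Y1; apply is_iso_cancell. Qed.

Lemma is_iso_cancelr (M : category) (X Y Z : M) (g : hom Y Z) (f : hom X Y) :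
  is_iso f -> is_iso (g ∘ f) -> is_iso g.
Proof.
intros [f' [f'f ff']] h.
replace g with (g ∘ f ∘ f') by (rewrite <- compA, ff', comp_idr; reflexivity).
apply is_iso_comp; [|exists f; split]; assumption.
Qed.

Lemma is_iso_tens (M : strict_monoidal) (X X' Y Y' : M) (f : hom X X') (g : hom Y Y') :
  is_iso f -> is_iso g -> is_iso (f ⊠ g).
Proof.
intros [f' [f'f ff']] [g' [g'g gg']]; exists (f' ⊠ g').
rewrite <- !tens_comp, f'f, ff', g'g, gg', !tens_id; split; reflexivity.
Qed.

Lemma is_iso_idm (M : category) (X : M) : is_iso (idm X).
Proof. exists (idm X); split; apply comp_idl. Qed.

(** * The Galois map and the transfer of convolution invertibility *)

Section GaloisMap.
Context {C D : strict_monoidal} {bar : strict_monoidal_functor C D}.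
Context (c : left_braiding bar) (H : bialg_data C) (hH : is_hopf_algebra c H).

Local Notation K := (fob (smf_functor bar) (bialg_ob H)).
Local Notation mK := (o21 (mulH (bar:=bar) H)).
Local Notation eK := (o01 (unitH (bar:=bar) H)).
Local Notation dK := (o12 (comulH (bar:=bar) H)).
Local Notation nK := (o10 (counitH (bar:=bar) H)).
Local Notation b V := (o22 (braid c H V)).

Lemma coalgH_coalgebra : is_coalgebra (coalgH (bar:=bar) H).
Proof.
split; [|split]; lw_goal.
- apply (comulH_assoc hH).
- apply (counit_comulHl hH).
- apply (counit_comulHr hH).
Qed.

Lemma comulHH_assoc Z :
  comulHH_family c H Z ▹ K ▹ K ∘ comulHH_family c H Z =
    comulHH_family c H (Z ⊗ K ⊗ K) ∘ comulHH_family c H Z.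
Proof.
unfold comulHH_family. slide.
rw (braid_nat12 c H). slide. rw (braid_comulH c H). slide.
rwr (comulH_assoc hH). rwr (o22_nat (braid c H K) (dK Z ▹ K)).
rwr (o22_nat (braid c H K) (dK Z)).
rw (comulH_assoc hH Z). slide.
Qed.

Lemma coalgHH_coalgebra : is_coalgebra (coalgHH c H).
Proof.
split; [|split]; lw_goal.
- apply comulHH_assoc.
- unfold comulHH_family; slide. unslide. rw (braid_nat10 c H). rw (counit_comulHl hH).
  rw (counit_comulHl hH). reflexivity.
- unfold comulHH_family; slide. rw (counit_comulHr hH). rw (braid_counitH c H).
  rw (counit_comulHr hH). reflexivity.
Qed.

Definition algH : alg_data D := @AlgData D K (mulH (bar:=bar) H) (unitH (bar:=bar) H).

Lemma algH_algebra : is_algebra algH.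
Proof.
split; [|split]; cbn [alg_ob mul unit algH]; lw_goal.
- apply (mulH_assoc hH).
- apply (mul_unitHl hH).
- apply (mul_unitHr hH).
Qed.

Lemma conv_fmap (f g : hom (bialg_ob H) (bialg_ob H)) :
  conv (K := bialg_coalg H) (A := bialg_alg H) f g = bunit H ∘ bcounit H ->
  conv (K := coalgH (bar:=bar) H) (A := algH) (fmap bar f) (fmap bar g)
    = unitH (bar:=bar) H ∘ counitH (bar:=bar) H.
Proof.
intros e; apply arr_eq_eq; unfold conv; cbn [mul unit comul alg_ob algH]; lw_goal.
unfold conv in e; cbn [mul comul alg_ob coalg_ob bialg_alg bialg_coalg] in e.
lw_use (arr_fmap bar (f_equal (@Arrow _ _ _) e)) (unit_ob : D).
Qed.

(** The Galois map is the map attached to the identity, whose convolution inverse is the image of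
    the antipode. *)
Lemma galois_iso : is_iso (conv_map (K := coalgH (bar:=bar) H) (A := algH) (idm K)).
Proof.
apply (conv_invertible_iso coalgH_coalgebra algH_algebra).
destruct (proj2 hH) as [a [ha ah]].
exists (fmap bar a); rewrite <- fmap_id; split; apply conv_fmap; assumption.
Qed.

(* Right multiplication by γ corresponds under the normal basis P to convolution
   with σ followed by the Galois map, which is invertible. *)
Lemma conv_invertible_normal_basis (A : cocycle_data (bar:=bar) H) (B : alg_data D)
    (P : hom (A ⊗ K) B) (g : hom K B) :
  is_algebra A -> is_algebra B -> is_iso P ->
  mul B ∘ (P ⊠ g) ≡ P ⊚ (mul A ⊠ idm K) ⊚ (idm A ⊠ coc_hat c A) ->
  @conv_invertible D (coalgHH c H) A (coc A) <->
  @conv_invertible D (coalgH (bar:=bar) H) B g.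
Proof.
intros hA hB hP e.
rewrite (conv_invertible_iso coalgHH_coalgebra hA).
rewrite (conv_invertible_iso coalgH_coalgebra hB).
set (gal := conv_map (K := coalgH (bar:=bar) H) (A := algH) (idm K)).
set (cs := conv_map (K := coalgHH c H) (A := A) (coc A)).
set (cg := conv_map (K := coalgH (bar:=bar) H) (A := B) g).
(* Since [P ⊠ idm K] and the whiskered Galois map are invertible, this square makes [cg] and [cs]
   invertible together. *)
assert (E : cg ∘ (P ⊠ idm K) ≡ (P ⊠ idm K) ⊚ (idm A ⊠ gal) ⊚ cs).
{ assert (eF : o21 (mul B) unit_ob ∘ o21 P unit_ob ▹ B ∘ o11 g (unit_ob ⊗ A ⊗ K) =
      o21 P unit_ob ∘ o21 (mul A) unit_ob ▹ K ∘ o22 (coc_hat c A) (unit_ob ⊗ A)).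
  { transitivity (o21 (mul B) unit_ob ∘ (o11 g (unit_ob ⊗ B) ∘ o21 P unit_ob ▹ K)).
    - slide.
    - lw_use e (unit_ob : D). }
  assert (lg : is_lw (unit_ob ⊗ A) gal (mK (unit_ob ⊗ A) ▹ K ∘ dK (unit_ob ⊗ A ⊗ K))).
  { unfold gal, conv_map; cbn [mul alg_ob algH].
    eapply lw_rhs; [lw|flat]. reflexivity. }
  assert (ls : is_lw unit_ob cs (o21 (mul A) unit_ob ▹ K ▹ K
      ∘ o21 (coc A) (unit_ob ⊗ A) ▹ K ▹ K ∘ comulHH_family c H (unit_ob ⊗ A))).
  { unfold cs, conv_map; lw. }
  assert (lc : is_lw unit_ob cg (o21 (mul B) unit_ob ▹ K
      ∘ o11 g (unit_ob ⊗ B) ▹ K ∘ dK (unit_ob ⊗ B))).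
  { unfold cg, conv_map; lw. }
  eapply lw_arr.
  - eapply lw_comp; [exact lc | lw].
  - eapply lw_ccomp; [eapply lw_ccomp; [lw | eapply lw_tensl; [|exact lg]] | exact ls].
    unfold ob_eq; reflexivity.
  - rewrite coc_hatE in eF.
    slide. rw eF. slide. unfold comulHH_family. slide. rw (comulH_assoc hH).
    reflexivity. }
assert (iP : is_iso (P ⊠ idm K)) by (apply is_iso_tens; [exact hP | apply is_iso_idm]).
assert (ig : is_iso (idm A ⊠ gal)) by (apply is_iso_tens;
  [apply is_iso_idm | apply galois_iso]).
clearbody gal cs cg; split; intros h.
- apply (is_iso_cancelr iP), (arr_iso (arr_sym E)).
  repeat apply is_iso_ccomp; assumption.
- pose proof (arr_iso E (is_iso_comp h iP)) as h'.
  refine (is_iso_ccancell _ h'); apply is_iso_ccomp; assumption.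
Qed.

End GaloisMap.

(** * The crossed product as a cleft extension *)

Section CrossedProductCleft.
Context {C D : strict_monoidal} {bar : strict_monoidal_functor C D}.
Context (c : left_braiding bar) (H : bialg_data C) (hH : is_hopf_algebra c H).

Local Notation K := (fob (smf_functor bar) (bialg_ob H)).
Local Notation mK := (o21 (mulH (bar:=bar) H)).
Local Notation eK := (o01 (unitH (bar:=bar) H)).
Local Notation dK := (o12 (comulH (bar:=bar) H)).
Local Notation nK := (o10 (counitH (bar:=bar) H)).
Local Notation b V := (o22 (braid c H V)).

Section Data.
Context (A : cocycle_data (bar:=bar) H).
Local Notation mA := (o21 (mul A)).
Local Notation eA := (o01 (unit A)).
Local Notation S := (o22 (coc_hat c A)).
Local Notation B := (crossed_product c A).

Lemma lw_crossed_mul Z : is_lw Z (crossed_mul c A) (crossed_mul_family c A Z).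
Proof. unfold crossed_mul; eapply lw_rhs; [lw|]. unfold crossed_mul_family; slide. Qed.
Lemma lw_crossed_product_mul Z : is_lw Z (mul B) (crossed_mul_family c A Z).
Proof. apply lw_crossed_mul. Qed.
Lemma lw_crossed_unit Z : is_lw Z (unit B) (eK (Z ⊗ A) ∘ eA Z).
Proof.
cbn [unit crossed_product cleft_coact coact_alg]; eapply lw_rhs; [lw|]; slide.
Qed.
Lemma lw_crossed_coact Z : is_lw Z (coact B) (dK (Z ⊗ A)).
Proof. cbn [coact crossed_product cleft_coact]; lw. Qed.
Lemma lw_crossed_sect Z : is_lw Z (sect B) (eA Z ▹ K).
Proof. cbn [sect crossed_product]; lw. Qed.
End Data.
#[local] Hint Resolve lw_crossed_product_mul lw_crossed_unit lw_crossed_coact lw_crossed_sect : lw.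

Context (A : cocycle_data (bar:=bar) H) (hA : is_measuring_cocycle c A).
Local Notation mA := (o21 (mul A)).
Local Notation eA := (o01 (unit A)).
Local Notation S := (o22 (coc_hat c A)).
Local Notation B := (crossed_product c A).

Lemma crossed_algebra : is_algebra B.
Proof.
split; [|split]; lw_goal.
- apply (crossed_mul_assoc hH hA).
- slide. rwr (o01_nat (unitH (bar:=bar) H) (eA unit_ob)). apply (crossed_e_mul hH hA).
- flat. apply (crossed_mul_e hH hA).
Qed.

Lemma crossed_comodule_algebra : is_comodule_algebra c B.
Proof.
split; [exact crossed_algebra|split; [split|split]].
- lw_goal. apply (comulH_assoc hH).
- lw_goal. apply (counit_comulHr hH).
- apply arr_eq_eq.
  assert (h0 : is_lw unit_ob (mul (tens_alg c B (bialg_alg H)))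
    (mK (unit_ob ⊗ A ⊗ K) ∘ crossed_mul_family c A unit_ob ▹ K ▹ K
      ∘ b K (unit_ob ⊗ A ⊗ K ⊗ A) ▹ K ∘ b A (unit_ob ⊗ A ⊗ K) ▹ K ▹ K)).
  { cbn [mul tens_alg]; change (mul (bialg_alg H)) with (bmul H).
    change (alg_ob (bialg_alg H)) with (bialg_ob H).
    change (braid c (bialg_ob H) (alg_ob (coact_alg (cleft_coact B))))
      with (braid c (bialg_ob H) (A ⊗ K)).
    eapply lw_rhs; [lw|]. flat. reflexivity. }
  eapply lw_arr; [lw | eapply lw_comp; [exact h0 | lw] |].
  (* Starting from the trivial coaction on the unit object, colinearity of the product becomes
     multiplicativity of the coaction. *)
  pose proof (crossed_colinear hH A (eK unit_ob)) as h; unfold colinear in h.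
  rewrite !coact_tens_unit, !(coact_tensK_unit hH) in h.
  rewrite h; unfold coact_tens, coact_tensK. slide.
- apply arr_eq_eq; cbn [unit tens_alg]; change (unit (bialg_alg H)) with (bunit H).
  lw_goal.
  slide. rw (comul_unitH hH). slide.
Qed.

Lemma crossed_mul_sect Z :
  crossed_mul_family c A Z ∘ eA (Z ⊗ A ⊗ K) ▹ K = mA Z ▹ K ∘ S (Z ⊗ A).
Proof.
unfold crossed_mul_family. rw (cnu_unit hH hA).
rw (o22_nat (coc_hat c A) (eA (Z ⊗ A))).
rw (meas_mul1r hA). reflexivity.
Qed.

(** Invertibility is inherited from σ: the identity serves as normal basis, because (a ⊗ h)(1 ⊗ l) =
    a S(h ⊗ l). *)
Lemma crossed_section : is_section (B := B) (sect B).
Proof.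
split.
- apply arr_eq_eq. lw_goal. slide.
- refine (proj1 (conv_invertible_normal_basis hH _ crossed_algebra (is_iso_idm _) _) _).
  + exact (proj1 (proj1 hA)).
  + lw_goal. flat. apply crossed_mul_sect.
  + exact (proj1 (proj2 hA)).
Qed.

Lemma crossed_cleft_pair : is_cleft_pair c B.
Proof.
split; [split; [exact crossed_comodule_algebra|exists (sect B);
  exact crossed_section]|].
split; [exact crossed_section|].
apply arr_eq_eq; lw_goal; slide.
Qed.

End CrossedProductCleft.

#[export] Hint Resolve lw_crossed_product_mul lw_crossed_unit lw_crossed_coact lw_crossed_sect : lw.

(** * Functoriality of the crossed product *)

Section CrossedProductMap.
Context {C D : strict_monoidal} {bar : strict_monoidal_functor C D}.
Context (c : left_braiding bar) (H : bialg_data C) (hH : is_hopf_algebra c H).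
Local Notation K := (fob (smf_functor bar) (bialg_ob H)).
Context (A A' : cocycle_data (bar:=bar) H) (f : hom A A') (hf : is_cocycle_mor f).

Local Notation dK := (o12 (comulH (bar:=bar) H)).
Local Notation T A := (o22 (cnu c A)).
Local Notation S A := (o22 (coc_hat c A)).

Let f_m Z : o11 f Z ∘ o21 (mul A) Z = o21 (mul A') Z ∘ o11 f Z ▹ A' ∘ o11 f (Z ⊗ A).
Proof.
rwr (o11_nat f (o11 f Z)). rewrite <- (compA (o21 (mul A') Z)).
lw_use (proj1 (proj1 (proj1 hf))) Z.
Qed.
Let f_u Z : o11 f Z ∘ o01 (unit A) Z = o01 (unit A') Z.
Proof. lw_use (proj2 (proj1 (proj1 hf))) Z. Qed.
Let f_v Z : o11 f Z ∘ o21 (act A) Z = o21 (act A') Z ∘ o11 f (Z ⊗ K).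
Proof. lw_use (proj2 (proj1 hf)) Z. Qed.
Let f_s Z : o11 f Z ∘ o21 (coc A) Z = o21 (coc A') Z.
Proof. lw_use (proj2 hf) Z. Qed.
Let f_T Z : o11 f Z ▹ K ∘ T A Z = T A' Z ∘ o11 f (Z ⊗ K).
Proof.
rewrite !cnuE; flat. rw f_v.
rwr (o11_nat f (dK Z)).
rw (braid_nat11 c H). reflexivity.
Qed.
Let f_S Z : o11 f Z ▹ K ∘ S A Z = S A' Z.
Proof. rewrite !coc_hatE; flat. rw f_s. reflexivity. Qed.

Lemma crossed_map_cleft :
  is_cleft_mor (B := crossed_product c A) (B' := crossed_product c A') (f ⊠ idm K).
Proof.
split; [split|split].
- apply arr_eq_eq; lw_goal.
  unfold crossed_mul_family; slide.
  rw f_m; slide. rw f_m; slide. rw f_S. rwr f_T. slide.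
- apply arr_eq_eq; lw_goal.
  slide. rw f_u. reflexivity.
- apply arr_eq_eq; lw_goal.
  slide.
- apply arr_eq_eq; lw_goal.
  slide. rw f_u. reflexivity.
Qed.
End CrossedProductMap.

(** * Coinvariants of a cleft extension *)

Section Coinvariants.
Context {C D : strict_monoidal} {bar : strict_monoidal_functor C D}.
Context (c : left_braiding bar) (H : bialg_data C) (hH : is_hopf_algebra c H).
Context (E : equalizers D).

Local Notation K := (fob (smf_functor bar) (bialg_ob H)).
Local Notation mK := (o21 (mulH (bar:=bar) H)).
Local Notation eK := (o01 (unitH (bar:=bar) H)).
Local Notation dK := (o12 (comulH (bar:=bar) H)).
Local Notation nK := (o10 (counitH (bar:=bar) H)).
Local Notation b V := (o22 (braid c H V)).

Context (B : cleft_data (bar:=bar) H) (hB : is_cleft_pair c B).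
Context (g' : hom K B).
Context (hg : @is_conv_inverse D (coalgH (bar:=bar) H) B (sect B) g').

Local Notation mB := (o21 (mul B)).
Local Notation eB := (o01 (unit B)).
Local Notation rho := (o12 (coact B)).
Local Notation g := (o11 (sect B)).
Local Notation gi := (o11 g').
Local Notation i := (o11 (coinv_mor E B)).
Local Notation A := (coinv E B).

Let hCA := proj1 (proj1 hB).
Lemma cleft_mulA Z : mB Z ∘ mB Z ▹ B = mB Z ∘ mB (Z ⊗ B).
Proof. lw_use (proj1 (proj1 hCA)) Z. Qed.
Lemma cleft_mul1l Z : mB Z ∘ eB Z ▹ B = idm (Z ⊗ B).
Proof. lw_use (proj1 (proj2 (proj1 hCA))) Z. Qed.
Lemma cleft_mul1r Z : mB Z ∘ eB (Z ⊗ B) = idm (Z ⊗ B).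
Proof. lw_use (proj2 (proj2 (proj1 hCA))) Z. Qed.
Lemma coact_coassoc Z : rho Z ▹ K ∘ rho Z = dK (Z ⊗ B) ∘ rho Z.
Proof. lw_use (proj1 (proj1 (proj2 hCA))) Z. Qed.
Lemma coact_counit Z : nK (Z ⊗ B) ∘ rho Z = idm (Z ⊗ B).
Proof. lw_use (proj2 (proj1 (proj2 hCA))) Z. Qed.
Lemma coact_mul Z : rho Z ∘ mB Z =
  mB Z ▹ K ∘ mK (Z ⊗ B ⊗ B) ∘ b B (Z ⊗ B) ▹ K ∘ rho Z ▹ B ▹ K ∘ rho (Z ⊗ B).
Proof.
pose proof (proj1 (proj2 (proj2 hCA))) as h; cbn [mul tens_alg] in h.
change (mul (bialg_alg H)) with (bmul H) in h;
  change (alg_ob (bialg_alg H)) with (bialg_ob H) in h.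
transitivity (mK (Z ⊗ B) ∘ mB Z ▹ K ▹ K ∘ b B (Z ⊗ B) ▹ K ∘ (rho (Z ⊗ B ⊗ K) ∘ rho Z ▹ B)).
- lw_use h Z.
- slide.
Qed.
Lemma coact_unit Z : rho Z ∘ eB Z = eK (Z ⊗ B) ∘ eB Z.
Proof.
pose proof (proj2 (proj2 (proj2 hCA))) as h; cbn [unit tens_alg] in h.
change (unit (bialg_alg H)) with (bunit H) in h.
lw_use h Z.
Qed.
Lemma coact_sect Z : rho Z ∘ g Z = g Z ▹ K ∘ dK Z.
Proof. lw_use (proj1 (proj1 (proj2 hB))) Z. Qed.
Lemma sect_conv_inv Z : mB Z ∘ g Z ▹ B ∘ gi (Z ⊗ K) ∘ dK Z = eB Z ∘ nK Z.
Proof.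
transitivity (mB Z ∘ (gi (Z ⊗ B) ∘ g Z ▹ K) ∘ dK Z); [slide|].
lw_use (proj1 hg) Z.
Qed.
Lemma inv_conv_sect Z : mB Z ∘ gi Z ▹ B ∘ g (Z ⊗ K) ∘ dK Z = eB Z ∘ nK Z.
Proof.
transitivity (mB Z ∘ (g (Z ⊗ B) ∘ gi Z ▹ K) ∘ dK Z); [slide|].
lw_use (proj2 hg) Z.
Qed.
Lemma sect_unitH Z : g Z ∘ eK Z = eB Z.
Proof. lw_use (proj2 (proj2 hB)) Z. Qed.
Lemma coact_coinv Z : rho Z ∘ i Z = eK (Z ⊗ B) ∘ i Z.
Proof. lw_use (eqz_eq E (coact B) (castm (idm B ⊠ unitH H))) Z. Qed.

Lemma sect_inv_unitH Z : gi Z ∘ eK Z = eB Z.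
Proof.
transitivity (mB Z ∘ g Z ▹ B ∘ gi (Z ⊗ K) ∘ dK Z ∘ eK Z).
- rw (comul_unitH hH). slide. rw sect_unitH. rw cleft_mul1l. reflexivity.
- rw sect_conv_inv. rw (counit_unitH hH). reflexivity.
Qed.

(* In Sweedler notation (1 ⊗ h1) rho (gi h2) = gi h ⊗ 1: insert gi h1 * g h2 = 1 and
   use that rho is multiplicative. *)
Lemma coact_sect_inv Z :
  mK (Z ⊗ B) ∘ b B Z ▹ K ∘ rho (Z ⊗ K) ∘ gi (Z ⊗ K) ∘ dK Z = eK (Z ⊗ B) ∘ gi Z.
Proof.
transitivity (mB Z ▹ K ∘ gi Z ▹ B ▹ K ∘ rho (Z ⊗ K) ∘ mB (Z ⊗ K) ∘ g (Z ⊗ K) ▹ B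
  ∘ gi (Z ⊗ K ⊗ K) ∘ dK (Z ⊗ K) ∘ dK Z).
- transitivity (mB Z ▹ K ∘ (mB Z ▹ B ▹ K ∘ gi Z ▹ B ▹ B ▹ K ∘ g (Z ⊗ K) ▹ B ▹ K ∘ dK Z ▹ B ▹ K)
    ∘ mK (Z ⊗ K ⊗ B) ∘ b B (Z ⊗ K) ▹ K ∘ rho (Z ⊗ K ⊗ K) ∘ gi (Z ⊗ K ⊗ K)
    ∘ dK (Z ⊗ K) ∘ dK Z).
  + flat. rw inv_conv_sect. rw cleft_mul1l. unslide. rw (counit_comulHl hH).
    reflexivity.
  + rw coact_mul. slide. rw coact_sect. slide. rw cleft_mulA.
    unslide. repeat rw (comulH_assoc hH). slide.
- rw sect_conv_inv. rw coact_unit. slide. rw (counit_comulHr hH).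
  rwr (o01_nat (unit B) (gi Z)). rw cleft_mul1r. slide.
Qed.

Definition coinv_part : hom B B := mul B ∘ (idm B ⊠ g') ∘ coact B.
Local Notation p := (o11 coinv_part).

Lemma coinv_partE Z : p Z = mB Z ∘ gi (Z ⊗ B) ∘ rho Z.
Proof. lw_unfold coinv_part at Z as coinv_part. Qed.

(** By multiplicativity and coassociativity the coaction of b0 γ^-(b1) contains (1 ⊗ b1)
    rho(γ^-(b2)), which [coact_sect_inv] replaces by γ^-(b1) ⊗ 1. *)
Lemma coact_coinv_part Z : rho Z ∘ p Z = eK (Z ⊗ B) ∘ p Z.
Proof.
rewrite coinv_partE; flat. rw coact_mul. unslide. rw coact_coassoc.
rw (o21_nat (mulH (bar:=bar) H) (mB Z)). rw coact_sect_inv. unslide.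
Qed.

Lemma coinv_part_id (X : D) (Z : D) (x : hom X (Z ⊗ B)) :
  rho Z ∘ x = eK (Z ⊗ B) ∘ x -> p Z ∘ x = x.
Proof.
intros hx; rewrite coinv_partE; flat. rw hx. rw sect_inv_unitH. rw cleft_mul1r.
reflexivity.
Qed.

Lemma coinv_part_eq :
  coact B ∘ coinv_part = castm (idm B ⊠ unitH (bar:=bar) H) ∘ coinv_part.
Proof. apply arr_eq_eq; lw_goal; apply coact_coinv_part. Qed.

Definition coinv_proj : hom B A := eqz_lift E coinv_part_eq.
Local Notation q := (o11 coinv_proj).

Lemma coinv_mor_proj Z : i Z ∘ q Z = p Z.
Proof. lw_use (eqz_liftK E coinv_part_eq) Z. Qed.

Lemma coinv_projK : coinv_proj ∘ coinv_mor E B = idm A.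
Proof.
apply (@eqz_uniq D E); apply arr_eq_eq.
change (eqz_mor E (coact B) (castm (idm B ⊠ unitH H))) with (coinv_mor E B).
lw_goal. flat. rw coinv_mor_proj. apply coinv_part_id, coact_coinv.
Qed.

Lemma coinv_proj_mor Z : q Z ∘ i Z = idm (Z ⊗ A).
Proof. lw_use coinv_projK Z. Qed.

(** Tensoring with [Z] need not preserve equalizers; the whiskered inclusion is monic because the
    projection is a left inverse. *)
Lemma coinv_mor_mono X Z (x y : hom X (Z ⊗ A)) : i Z ∘ x = i Z ∘ y -> x = y.
Proof.
intros e; rewrite <- (comp_idl x), <- (comp_idl y), <- coinv_proj_mor, <- !compA, e;
  reflexivity.
Qed.

(** * The normal basis isomorphism Ψ *)

Definition norm_basis : hom (A ⊗ K) B := mul B ∘ (coinv_mor E B ⊠ sect B).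
Local Notation psi := (o21 norm_basis).

Lemma norm_basisE Z : psi Z = mB Z ∘ i Z ▹ B ∘ g (Z ⊗ A).
Proof.
transitivity (mB Z ∘ (g (Z ⊗ B) ∘ i Z ▹ K)); [|slide].
lw_unfold norm_basis at Z as norm_basis.
Qed.

Lemma coinv_part_sect Z : mB Z ∘ g (Z ⊗ B) ∘ p Z ▹ K ∘ rho Z = idm (Z ⊗ B).
Proof.
rewrite coinv_partE; slide. rw cleft_mulA.
rwr (o11_nat (sect B) (rho Z)). rw coact_coassoc. rw inv_conv_sect. rw cleft_mul1r.
rw coact_counit. reflexivity.
Qed.

Lemma coact_norm_basis Z : rho Z ∘ psi Z = psi Z ▹ K ∘ dK (Z ⊗ A).
Proof.
rewrite norm_basisE; flat. rw coact_mul. unslide. rw coact_coinv. slide. rw coact_sect.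
slide.
rw (braid_unitH c H). rw (mul_unitHl hH). reflexivity.
Qed.

(** As Ψ is colinear, p(a γ(h)) = a γ(h1) γ^-(h2) = a ε(h). *)
Lemma coinv_proj_norm_basis_family Z : q Z ∘ psi Z = nK (Z ⊗ A).
Proof.
apply coinv_mor_mono; flat. rw coinv_mor_proj. rewrite coinv_partE; flat.
rw coact_norm_basis.
rewrite norm_basisE; flat.
transitivity (mB Z ∘ mB Z ▹ B ∘ i Z ▹ B ▹ B ∘ g (Z ⊗ A) ▹ B ∘ gi (Z ⊗ A ⊗ K) ∘ dK (Z ⊗ A)).
{ slide. }
rw cleft_mulA.
transitivity (mB Z ∘ i Z ▹ B ∘ mB (Z ⊗ A) ∘ g (Z ⊗ A) ▹ B ∘ gi (Z ⊗ A ⊗ K) ∘ dK (Z ⊗ A)).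
{ slide. }
rw sect_conv_inv.
rwr (o01_nat (unit B) (i Z)). rw cleft_mul1r. slide.
Qed.

Lemma coinv_proj_norm_basis : coinv_proj ∘ norm_basis ≡ idm A ⊠ counitH (bar:=bar) H.
Proof. lw_goal; apply coinv_proj_norm_basis_family. Qed.

Definition norm_basis_inv : hom B (A ⊗ K) := (coinv_proj ⊠ idm K) ∘ coact B.
Local Notation psi' := (o12 norm_basis_inv).

Lemma norm_basis_invE Z : psi' Z = q Z ▹ K ∘ rho Z.
Proof. lw_unfold norm_basis_inv at Z as norm_basis_inv. Qed.

Lemma norm_basisK Z : psi Z ∘ psi' Z = idm (Z ⊗ B).
Proof.
rewrite norm_basisE, norm_basis_invE.
transitivity (mB Z ∘ g (Z ⊗ B) ∘ i Z ▹ K ∘ q Z ▹ K ∘ rho Z); [slide|].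
rw coinv_mor_proj. rw coinv_part_sect. reflexivity.
Qed.

Lemma norm_basis_invK Z : psi' Z ∘ psi Z = idm (Z ⊗ A ⊗ K).
Proof.
rewrite norm_basis_invE; flat. rw coact_norm_basis. rw coinv_proj_norm_basis_family.
rw (counit_comulHl hH). reflexivity.
Qed.

Lemma norm_basis_mono X Z (x y : hom X (Z ⊗ A ⊗ K)) : psi Z ∘ x = psi Z ∘ y -> x = y.
Proof.
intros e; rewrite <- (comp_idl x), <- (comp_idl y), <- norm_basis_invK, <- !compA, e;
  reflexivity.
Qed.

(** Composing with the projection replaces every lift through the equalizer by a formula: products
    of coinvariants are unchanged, γ(h) a becomes γ(h1) a γ^-(h2), and γ(h) γ(l) becomes γ(h1) γ(l1)
    γ^-(h2 l2). *)
Definition coinv_alg : alg_data D :=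
  @AlgData D A (coinv_proj ∘ mul B ∘ (coinv_mor E B ⊠ coinv_mor E B)) (coinv_proj ∘ unit B).
Definition coinv_meas : measuring_data (bar:=bar) H :=
  @MeasuringData _ _ _ _ coinv_alg (coinv_proj ∘ mul B ∘ (sect B ⊠ coinv_mor E B)).
Definition coinv_cocycle : cocycle_data (bar:=bar) H :=
  @CocycleData _ _ _ _ coinv_meas (coinv_proj ∘ mul B ∘ (sect B ⊠ sect B)).

Local Notation mA := (@o21 D A A A (mul coinv_alg)).
Local Notation eA := (@o01 D A (unit coinv_alg)).
Local Notation v := (@o21 D K A A (act coinv_meas)).
Local Notation s := (@o21 D K K A (coc coinv_cocycle)).
Local Notation T := (@o22 D K A A K (cnu c coinv_meas)).
Local Notation S := (@o22 D K K A K (coc_hat c coinv_cocycle)).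

Lemma coinv_mulE Z : mA Z = q Z ∘ mB Z ∘ i Z ▹ B ∘ i (Z ⊗ A).
Proof.
transitivity (q Z ∘ mB Z ∘ (i (Z ⊗ B) ∘ i Z ▹ A)); [|slide].
lw_compute (mul coinv_alg) at Z by (cbn [mul coinv_alg]).
Qed.
Lemma coinv_actE Z : v Z = q Z ∘ mB Z ∘ g Z ▹ B ∘ i (Z ⊗ K).
Proof.
transitivity (q Z ∘ mB Z ∘ (i (Z ⊗ B) ∘ g Z ▹ A)); [|slide].
lw_compute (act coinv_meas) at Z by (cbn [act coinv_meas]).
Qed.
Lemma coinv_cocE Z : s Z = q Z ∘ mB Z ∘ g Z ▹ B ∘ g (Z ⊗ K).
Proof.
transitivity (q Z ∘ mB Z ∘ (g (Z ⊗ B) ∘ g Z ▹ K)); [|slide].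
lw_compute (coc coinv_cocycle) at Z by (cbn [coc coinv_cocycle]).
Qed.
Lemma coinv_unitE Z : eA Z = q Z ∘ eB Z.
Proof.
lw_compute (unit coinv_alg) at Z by (cbn [unit coinv_alg]).
Qed.

Lemma coinv_mor_mul Z : i Z ∘ mA Z = mB Z ∘ i Z ▹ B ∘ i (Z ⊗ A).
Proof.
rewrite coinv_mulE; flat. rw coinv_mor_proj.
rewrite <- !compA; apply coinv_part_id; flat.
rw coact_mul. unslide. repeat rw coact_coinv. slide. rw (braid_unitH c H).
rw (mul_unitHl hH). unslide.
Qed.

Lemma coinv_mor_unit Z : i Z ∘ eA Z = eB Z.
Proof. rewrite coinv_unitE; flat. rw coinv_mor_proj. apply coinv_part_id, coact_unit.
Qed.

Let T_E Z : T Z = v Z ▹ K ∘ b A (Z ⊗ K) ∘ dK Z ▹ A.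
Proof. exact (cnuE c coinv_cocycle Z). Qed.
Let S_E Z : S Z = s Z ▹ K ∘ mK (Z ⊗ K ⊗ K) ∘ comulHH_family c H Z.
Proof. exact (coc_hatE c coinv_cocycle Z). Qed.
Let n_T Z : nK (Z ⊗ A) ∘ T Z = v Z.
Proof. exact (counit_cnu hH coinv_cocycle Z). Qed.
Let n_S Z : nK (Z ⊗ A) ∘ S Z = s Z.
Proof. exact (counit_coc_hat hH coinv_cocycle Z). Qed.

(** As a is coinvariant, the coaction of γ(h) a is γ(h1) a ⊗ h2, and the projection turns γ(h1) a
    into h1·a. *)
Lemma norm_basis_inv_cnu Z : psi' Z ∘ mB Z ∘ g Z ▹ B ∘ i (Z ⊗ K) = T Z.
Proof.
rewrite T_E, coinv_actE, norm_basis_invE; flat.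
rw coact_mul. unslide. rw coact_coinv. slide. rw coact_sect. unslide.
rw (mul_unitHr hH).
rw (braid_nat11 c H). unslide.
Qed.

Lemma norm_basis_inv_coc_hat Z : psi' Z ∘ mB Z ∘ g Z ▹ B ∘ g (Z ⊗ K) = S Z.
Proof.
rewrite S_E, coinv_cocE, norm_basis_invE; unfold comulHH_family; flat.
rw coact_mul. slide. rw coact_sect. rw coact_sect. unslide. rw (braid_nat11 c H). slide.
Qed.

Lemma norm_basis_cnu Z : psi Z ∘ T Z = mB Z ∘ g Z ▹ B ∘ i (Z ⊗ K).
Proof. rewrite <- norm_basis_inv_cnu; flat. rw norm_basisK. reflexivity. Qed.
Lemma norm_basis_coc_hat Z : psi Z ∘ S Z = mB Z ∘ g Z ▹ B ∘ g (Z ⊗ K).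
Proof. rewrite <- norm_basis_inv_coc_hat; flat. rw norm_basisK. reflexivity. Qed.
Lemma norm_basis_mul Z : psi Z ∘ mA Z ▹ K = mB Z ∘ i Z ▹ B ∘ psi (Z ⊗ A).
Proof.
rewrite !norm_basisE; flat. slide. rw coinv_mor_mul. slide. rw cleft_mulA. slide.
Qed.
Lemma norm_basis_unit Z : psi Z ∘ eA Z ▹ K = g Z.
Proof. rewrite norm_basisE; slide. rw coinv_mor_unit. rw cleft_mul1l. reflexivity. Qed.

Ltac coinv_simpl := cbn [alg_ob meas_alg coc_meas coinv_alg coinv_meas coinv_cocycle].

Lemma coinv_algebra : is_algebra coinv_alg.
Proof.
split; [|split]; lw_goal; coinv_simpl; apply coinv_mor_mono; flat.
- repeat (rw coinv_mor_mul; slide). rw cleft_mulA. slide.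
- rw coinv_mor_mul. slide. rw coinv_mor_unit. rw cleft_mul1l. reflexivity.
- rw coinv_mor_mul. slide. rw coinv_mor_unit. rwr (o01_nat (unit B) (i unit_ob)).
  rw cleft_mul1r. reflexivity.
Qed.

Lemma mul_norm_basis Z : mB Z ∘ i Z ▹ B ∘ mB (Z ⊗ A) ∘ g (Z ⊗ A) ▹ B = mB Z ∘ psi Z ▹ B.
Proof. rewrite norm_basisE; flat. rw cleft_mulA. slide. Qed.

Lemma norm_basis_mul_cnu Z :
  psi Z ∘ mA Z ▹ K ∘ T (Z ⊗ A) = mB Z ∘ psi Z ▹ B ∘ i (Z ⊗ A ⊗ K).
Proof. rw norm_basis_mul. rw norm_basis_cnu. rw mul_norm_basis. reflexivity. Qed.
Lemma norm_basis_mul_coc_hat Z :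
  psi Z ∘ mA Z ▹ K ∘ S (Z ⊗ A) = mB Z ∘ psi Z ▹ B ∘ g (Z ⊗ A ⊗ K).
Proof. rw norm_basis_mul. rw norm_basis_coc_hat. rw mul_norm_basis. reflexivity. Qed.

(** Under Ψ both sides become γ(h) γ(l) a. Likewise the next two identities reduce to γ(h) γ(l) γ(m)
    and γ(h) a b. *)
Lemma coinv_coc_hat_twisted Z :
  mA Z ▹ K ∘ T (Z ⊗ A) ∘ S Z ▹ A = mA Z ▹ K ∘ S (Z ⊗ A) ∘ T Z ▹ K ∘ T (Z ⊗ K).
Proof.
apply norm_basis_mono; flat. rw norm_basis_mul_cnu. rw norm_basis_mul_coc_hat. slide.
rw norm_basis_coc_hat. rw norm_basis_cnu. slide.
rw cleft_mulA. slide. rwr norm_basisE. rw norm_basis_cnu. slide.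
Qed.

Lemma coinv_coc_hat_cocycle Z :
  mA Z ▹ K ∘ S (Z ⊗ A) ∘ S Z ▹ K = mA Z ▹ K ∘ S (Z ⊗ A) ∘ T Z ▹ K ∘ S (Z ⊗ K).
Proof.
apply norm_basis_mono; flat. rw norm_basis_mul_coc_hat. slide. rw norm_basis_coc_hat.
rw norm_basis_cnu. slide.
rw cleft_mulA. slide. rwr norm_basisE. rw norm_basis_coc_hat. slide.
Qed.

Lemma coinv_cnu_mul Z : T Z ∘ mA (Z ⊗ K) = mA Z ▹ K ∘ T (Z ⊗ A) ∘ T Z ▹ A.
Proof.
apply norm_basis_mono; flat. rw norm_basis_cnu. rw norm_basis_mul_cnu. rw coinv_mor_mul.
slide. rw norm_basis_cnu. slide. rw cleft_mulA. slide.
Qed.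

Lemma coinv_measuring : is_measuring c coinv_meas.
Proof.
split; [exact coinv_algebra|split; [|split]].
- lw_goal; coinv_simpl. rewrite coinv_actE; flat. slide. rw sect_unitH. rw cleft_mul1l.
  apply coinv_proj_mor.
- lw_goal; coinv_simpl. rewrite coinv_actE; flat. rw coinv_mor_unit.
  rwr (o01_nat (unit B) (g unit_ob)). rw cleft_mul1r. rewrite <- norm_basis_unit; flat.
  rw coinv_proj_norm_basis_family.
  slide.
- lw_goal; coinv_simpl.
  transitivity (mA unit_ob ∘ v (unit_ob ⊗ A) ∘ T unit_ob ▹ A).
  (* The measuring axiom is the composite of the identity [coinv_cnu_mul] with the counit. *)
  + rewrite <- n_T; flat. rw coinv_cnu_mul. slide. rw n_T. reflexivity.
  + rewrite T_E; slide.
Qed.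

Lemma coinv_is_cocycle : is_cocycle c coinv_cocycle.
Proof.
split; [|split; [|split]].
- assert (P : is_iso norm_basis).
  { exists norm_basis_inv; split; apply arr_eq_eq; lw_goal;
      [apply norm_basis_invK | apply norm_basisK]. }
  (* The converse transfer: Ψ is the normal basis, and γ is invertible by assumption. *)
  refine (proj2 (conv_invertible_normal_basis hH (A := coinv_cocycle)
            (g := sect B) coinv_algebra (proj1 hCA) P _) _).
  + lw_goal; coinv_simpl.
    rw norm_basis_mul_coc_hat. slide.
  + exact (proj2 (proj1 (proj2 hB))).
- lw_goal; coinv_simpl.
  (* Both cocycle conditions come from their lifted forms by applying the counit. *)
  transitivity (nK (unit_ob ⊗ A) ∘ mA unit_ob ▹ K ∘ S (unit_ob ⊗ A) ∘ S unit_ob ▹ K).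
  + slide. rw n_S. reflexivity.
  + rw coinv_coc_hat_cocycle. slide. rw n_S. reflexivity.
- lw_goal; coinv_simpl.
  transitivity (nK (unit_ob ⊗ A) ∘ mA unit_ob ▹ K ∘ T (unit_ob ⊗ A) ∘ S unit_ob ▹ A).
  + slide. rw n_T. reflexivity.
  + rw coinv_coc_hat_twisted. slide. rw n_S. reflexivity.
- lw_goal; coinv_simpl. rewrite coinv_cocE; slide. rw sect_unitH. rw sect_unitH.
  rw cleft_mul1l.
  rewrite coinv_unitE. reflexivity.
Qed.

Lemma coinv_measuring_cocycle : is_measuring_cocycle c coinv_cocycle.
Proof. split; [exact coinv_measuring | exact coinv_is_cocycle]. Qed.

Lemma coinv_mor_inj X (x y : hom X A) : coinv_mor E B ∘ x = coinv_mor E B ∘ y -> x = y.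
Proof. apply eqz_uniq. Qed.

Lemma coinv_unique_lift X (x : hom X A) (y : hom X B) :
  coinv_mor E B ∘ x = y -> unique (fun x => coinv_mor E B ∘ x = y) x.
Proof.
intros e; split; [exact e|intros x' e']; apply coinv_mor_inj; rewrite e, e';
  reflexivity. Qed.

Lemma coinv_is_coinv_cocycle : is_coinv_cocycle c E B coinv_cocycle.
Proof.
apply (CoinvCocycle (g' := g')); [exact hg|..]; apply coinv_unique_lift.
- apply arr_eq_eq; lw_goal; slide. rwr coinv_mulE. rw coinv_mor_mul. reflexivity.
- apply arr_eq_eq; lw_goal; flat. rwr coinv_unitE. rw coinv_mor_unit. reflexivity.
- apply arr_eq_eq; lw_goal; flat. rw coinv_mor_proj. rewrite coinv_partE; flat.
  rw coact_mul.
  unslide. rw coact_coinv. unslide. slide. rw coact_sect. unslide.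
 rw (mul_unitHr hH). rw (braid_nat11 c H). slide.
- apply arr_eq_eq; lw_goal; flat. rw coinv_mor_proj.
  rewrite coinv_partE; unfold comulHH_family; flat. rw coact_mul.
  slide. rw coact_sect. rw coact_sect. unslide.
 rw (braid_nat11 c H). slide.
Qed.

End Coinvariants.

Section CoinvariantsMap.
Context {C D : strict_monoidal} {bar : strict_monoidal_functor C D}.
Context (c : left_braiding bar) (H : bialg_data C) (hH : is_hopf_algebra c H).
Context (E : equalizers D).
Local Notation K := (fob (smf_functor bar) (bialg_ob H)).
Local Notation nK := (o10 (counitH (bar:=bar) H)).
Context (B B' : cleft_data (bar:=bar) H) (hB : is_cleft_pair c B) (hB' : is_cleft_pair c B').
Context (g g' : hom K B) (h : hom K B').

End CoinvariantsMap.

(** * Functoriality of the coinvariants *)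

Section CoinvariantsMap.
Context {C D : strict_monoidal} {bar : strict_monoidal_functor C D}.
Context (c : left_braiding bar) (H : bialg_data C) (hH : is_hopf_algebra c H).
Context (E : equalizers D).

Local Notation K := (fob (smf_functor bar) (bialg_ob H)).
Local Notation nK := (o10 (counitH (bar:=bar) H)).

Context (B B' : cleft_data (bar:=bar) H).
Context (hB : is_cleft_pair c B) (hB' : is_cleft_pair c B').
Context (g : hom K B) (hg : @is_conv_inverse D (coalgH (bar:=bar) H) B (sect B) g).
Context (g' : hom K B') (hg' : @is_conv_inverse D (coalgH (bar:=bar) H) B' (sect B') g').
Context (f : hom B B') (hf : is_cleft_mor f).

Local Notation A := (coinv E B).
Local Notation A' := (coinv E B').
Local Notation i := (o11 (coinv_mor E B)).
Local Notation i' := (o11 (coinv_mor E B')).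
Local Notation q := (o11 (coinv_proj hH E hB hg)).
Local Notation q' := (o11 (coinv_proj hH E hB' hg')).
Local Notation psi := (o21 (norm_basis E B)).
Local Notation psi' := (o21 (norm_basis E B')).

Let f_m Z : o11 f Z ∘ o21 (mul B) Z = o21 (mul B') Z ∘ o11 f Z ▹ B' ∘ o11 f (Z ⊗ B).
Proof.
rwr (o11_nat f (o11 f Z)). rewrite <- (compA (o21 (mul B') Z)).
lw_use (proj1 (proj1 hf)) Z.
Qed.
Let f_e Z : o11 f Z ∘ o01 (unit B) Z = o01 (unit B') Z.
Proof. lw_use (proj2 (proj1 hf)) Z. Qed.
Let f_rho Z : o12 (coact B') Z ∘ o11 f Z = o11 f Z ▹ K ∘ o12 (coact B) Z.
Proof. lw_use (proj1 (proj2 hf)) Z. Qed.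
Let f_g Z : o11 f Z ∘ o11 (sect B) Z = o11 (sect B') Z.
Proof. lw_use (proj2 (proj2 hf)) Z. Qed.

Lemma coinv_map_eq : coact B' ∘ (f ∘ coinv_mor E B) =
  castm (idm B' ⊠ unitH (bar:=bar) H) ∘ (f ∘ coinv_mor E B).
Proof.
apply arr_eq_eq; lw_goal; flat. rw f_rho. rw (coact_coinv (H := H) E B). slide.
Qed.

Definition coinv_map : hom A A' := eqz_lift E coinv_map_eq.
Local Notation Gf := (o11 coinv_map).

Lemma coinv_mapE : coinv_mor E B' ∘ coinv_map = f ∘ coinv_mor E B.
Proof. apply eqz_liftK. Qed.

Let i_G Z : i' Z ∘ Gf Z = o11 f Z ∘ i Z.
Proof. lw_use coinv_mapE Z. Qed.

Let f_psi Z : psi' Z ∘ Gf Z ▹ K = o11 f Z ∘ psi Z.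
Proof.
rewrite !norm_basisE; flat. rw f_m. slide. rw i_G. rw f_g. slide.
Qed.

Lemma norm_basis_nat :
  norm_basis E B' ∘ (coinv_map ⊠ idm K) = f ∘ norm_basis E B.
Proof. apply arr_eq_eq; lw_goal; apply f_psi. Qed.

(** Checked after composing with the isomorphism Ψ, which is natural and turns both projections into
    id ⊗ ε; this avoids comparing the convolution inverses of the two sections. *)
Let q_f Z : q' Z ∘ o11 f Z = Gf Z ∘ q Z.
Proof.
rewrite <- (comp_idr (q' Z ∘ o11 f Z)), <- (norm_basisK hH E hB hg), compA, <- (compA (q' Z)).
rewrite <- f_psi, compA, coinv_proj_norm_basis_family.
rewrite <- (comp_idr (Gf Z ∘ q Z)), <- (norm_basisK hH E hB hg), compA, <- (compA (Gf Z)), coinv_proj_norm_basis_family.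
slide.
Qed.

Lemma coinv_map_cocycle_mor :
  is_cocycle_mor (A := coinv_cocycle hH E hB hg) (A' := coinv_cocycle hH E hB' hg') coinv_map.
Proof.
split; [split; [split|]|].
- apply arr_eq_eq; lw_goal;
    cbn [alg_ob meas_alg coc_meas coinv_alg coinv_meas coinv_cocycle].
  rewrite !coinv_mulE; flat. rwr q_f. rw f_m. slide. rw i_G. rw i_G. slide.
- apply arr_eq_eq; lw_goal;
    cbn [alg_ob meas_alg coc_meas coinv_alg coinv_meas coinv_cocycle].
  rewrite !coinv_unitE; flat. rwr q_f. rw f_e. reflexivity.
- apply arr_eq_eq; lw_goal;
    cbn [alg_ob meas_alg coc_meas coinv_alg coinv_meas coinv_cocycle].
  rewrite !coinv_actE; flat. rwr q_f. rw f_m. rw i_G. slide. rw f_g. slide.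
- apply arr_eq_eq; lw_goal;
    cbn [alg_ob meas_alg coc_meas coinv_alg coinv_meas coinv_cocycle].
  rewrite !coinv_cocE; flat. rwr q_f. rw f_m. slide. rw f_g. rw f_g. reflexivity.
Qed.
End CoinvariantsMap.

(** * The equivalence *)

Section Counit.
Context {C D : strict_monoidal} {bar : strict_monoidal_functor C D}.
Context (c : left_braiding bar) (H : bialg_data C) (hH : is_hopf_algebra c H).
Context (E : equalizers D).
Local Notation K := (fob (smf_functor bar) (bialg_ob H)).
Context (B : cleft_data (bar:=bar) H) (hB : is_cleft_pair c B).
Context (g : hom K B) (hg : @is_conv_inverse D (coalgH (bar:=bar) H) B (sect B) g).
Local Notation psi := (o21 (norm_basis E B)).

(** Multiplicativity holds because Ψ T and Ψ S are the products γ(h) b and γ(h) γ(l), so the crossed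
    product of a ⊗ h and b ⊗ l is sent to a γ(h) b γ(l). *)
Lemma norm_basis_cleft_mor :
  is_cleft_mor (B := crossed_product c (coinv_cocycle hH E hB hg)) (B' := B) (norm_basis E B).
Proof.
pose (A := coinv E B); pose (mA := @o21 D A A A (mul (coinv_alg hH E hB hg))).
assert (hmA : forall Z, mA Z ∘ mA Z ▹ A = mA Z ∘ mA (Z ⊗ A)).
{ intros Z; lw_use (proj1 (coinv_algebra hH E hB hg)) Z. }
unfold mA, A in hmA; clear mA A.
split; [split|split].
- apply arr_eq_eq; lw_goal; unfold crossed_mul_family;
    cbn [alg_ob meas_alg coc_meas coinv_alg coinv_meas coinv_cocycle]; flat.
  rw hmA. rw (norm_basis_mul hH E hB hg). rw (norm_basis_mul_coc_hat hH E hB hg). slide.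
  rw (norm_basis_cnu hH E hB hg).
  rewrite !norm_basisE; slide. repeat (rw (cleft_mulA hB); slide).
- apply arr_eq_eq; lw_goal;
    cbn [alg_ob meas_alg coc_meas coinv_alg coinv_meas coinv_cocycle]; flat.
  rewrite norm_basisE; slide. rw (sect_unitH hB). rw (coinv_mor_unit hH E hB hg).
  rw (cleft_mul1l hB). reflexivity.
- apply arr_eq_eq; lw_goal. apply (coact_norm_basis hH E hB).
- apply arr_eq_eq; lw_goal. apply (norm_basis_unit hH E hB hg).
Qed.

Lemma norm_basis_iso : is_iso (norm_basis E B).
Proof.
exists (norm_basis_inv hH E hB hg); split; apply arr_eq_eq; lw_goal;
  [apply norm_basis_invK | apply norm_basisK].
Qed.
End Counit.

(** * A cocycle pair and the coinvariants of its crossed product *)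

Section Unit.
Context {C D : strict_monoidal} {bar : strict_monoidal_functor C D}.
Context (c : left_braiding bar) (H : bialg_data C) (hH : is_hopf_algebra c H).
Context (E : equalizers D).
Local Notation K := (fob (smf_functor bar) (bialg_ob H)).
Local Notation mK := (o21 (mulH (bar:=bar) H)).
Local Notation eK := (o01 (unitH (bar:=bar) H)).
Local Notation dK := (o12 (comulH (bar:=bar) H)).
Local Notation nK := (o10 (counitH (bar:=bar) H)).
Context (A : cocycle_data (bar:=bar) H) (hA : is_measuring_cocycle c A).
Local Notation B := (crossed_product c A).
Let hB : is_cleft_pair c B := crossed_cleft_pair hH hA.
Context (g : hom K B) (hg : @is_conv_inverse D (coalgH (bar:=bar) H) B (sect B) g).

Local Notation q := (coinv_proj hH E hB hg).
Local Notation mA := (o21 (mul A)).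
Local Notation eA := (o01 (unit A)).
Local Notation A' := (coinv E B).

Definition crossed_incl : hom A B := castm (idm A ⊠ unitH (bar:=bar) H).

Let lw_incl Z : is_lw Z crossed_incl (eK (Z ⊗ A)).
Proof. unfold crossed_incl; lw. Qed.
#[local] Hint Resolve lw_incl : lw.

Lemma crossed_incl_eq : coact B ∘ crossed_incl =
  castm (idm B ⊠ unitH (bar:=bar) H) ∘ crossed_incl.
Proof. apply arr_eq_eq; lw_goal. rw (comul_unitH hH). slide. Qed.

Definition crossed_unit : hom A A' := eqz_lift E crossed_incl_eq.
Local Notation j := crossed_unit.

Lemma crossed_unitE : coinv_mor E B ∘ j = crossed_incl.
Proof. apply eqz_liftK. Qed.

(** This is (a ⊗ 1)(1 ⊗ h) = a ⊗ h in the crossed product. *)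
Lemma norm_basis_crossed : norm_basis E B ∘ (j ⊠ idm K) = idm (A ⊗ K).
Proof.
unfold norm_basis. rewrite <- compA, <- tens_comp, crossed_unitE, comp_idr.
apply arr_eq_eq; lw_goal.
flat. rw (crossed_mul_sect hH hA). rw (coc_hat_unitl hH hA). rw (meas_mul1r hA).
reflexivity.
Qed.

(** Compose q Ψ = id ⊗ ε with j ⊗ id, a right inverse of Ψ. This describes the projection without a
    formula for γ^-. *)
Let q_E Z : o21 q Z = o11 j Z ∘ nK (Z ⊗ A).
Proof.
pose proof (coinv_proj_norm_basis hH E hB hg) as e.
assert (e' : q ≡ (idm A' ⊠ counitH (bar:=bar) H) ∘ (j ⊠ idm K)).
{ pose proof (arr_comp e (arr_refl (j ⊠ idm K))) as h.
  rewrite <- compA, norm_basis_crossed in h.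
  refine (arr_trans _ h); rewrite (comp_idr (X := B)); reflexivity. }
rewrite <- o10_nat. lw_use e' Z.
Qed.

(** This and the next two products are those that define the structure of the coinvariants; id ⊗ ε
    then returns the multiplication, action and cocycle of [A]. *)
Let crossed_mul_11 Z :
  crossed_mul_family c A Z ∘ eK (Z ⊗ A ⊗ K ⊗ A) ∘ eK (Z ⊗ A) ▹ A = eK (Z ⊗ A) ∘ mA Z.
Proof.
unfold crossed_mul_family.
rwr (o01_nat (unitH (bar:=bar) H)). rw (cnu_unitH hH hA). rw (coc_hat_unitr hH hA).
rwr (o01_nat (unit A) (mA Z)). rw (meas_mul1r hA). slide.
Qed.

Let crossed_mul_T Z :
  crossed_mul_family c A Z ∘ eK (Z ⊗ A ⊗ K ⊗ A) ∘ eA Z ▹ K ▹ A = o22 (cnu c A) Z.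
Proof.
unfold crossed_mul_family.
rwr (o01_nat (unitH (bar:=bar) H)). rw (coc_hat_unitr hH hA).
rwr (o01_nat (unit A) (mA Z)). rw (meas_mul1r hA). slide. rw (meas_mul1l hA).
reflexivity.
Qed.

Let crossed_mul_S Z :
  crossed_mul_family c A Z ∘ eA (Z ⊗ A ⊗ K) ▹ K ∘ eA Z ▹ K ▹ K = o22 (coc_hat c A) Z.
Proof.
rw (crossed_mul_sect hH hA). slide. rw (meas_mul1l hA). reflexivity.
Qed.

Lemma crossed_unit_cocycle_mor :
  is_cocycle_mor (A := A) (A' := coinv_cocycle hH E hB hg) j.
Proof.
pose proof crossed_unitE as ij.
split; [split; [split|]|].
- transitivity (q ∘ (mul B ∘ (crossed_incl ⊠ crossed_incl))).
  2: { transitivity (q ∘ mul B ∘ (coinv_mor E B ⊠ coinv_mor E B) ∘ (j ⊠ j));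
    [|reflexivity].
       rewrite <- !compA, <- tens_comp, ij; reflexivity. }
  apply arr_eq_eq; lw_goal. flat. rewrite q_E. rw crossed_mul_11. rw (counit_unitH hH).
  reflexivity.
- transitivity (q ∘ unit B); [|reflexivity].
  apply arr_eq_eq; lw_goal. rewrite q_E; flat. rw (counit_unitH hH). reflexivity.
- transitivity (q ∘ (mul B ∘ (sect B ⊠ crossed_incl))).
  2: { transitivity (q ∘ mul B ∘ (sect B ⊠ coinv_mor E B) ∘ (idm K ⊠ j));
    [|reflexivity].
       rewrite <- !compA, <- tens_comp, ij, comp_idr; reflexivity. }
  apply arr_eq_eq; lw_goal. flat. rewrite q_E; flat. rw crossed_mul_T.
  rw (counit_cnu hH). reflexivity.
- transitivity (q ∘ (mul B ∘ (sect B ⊠ sect B))).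
  2: { rewrite !compA; reflexivity. }
  apply arr_eq_eq; lw_goal. flat. rewrite q_E; flat. rw crossed_mul_S.
  rw (counit_coc_hat hH). reflexivity.
Qed.

Lemma crossed_unit_iso : is_iso j.
Proof.
(* One composite is a |-> a ε(1); the other is the projection after the inclusion, by [q_E]. *)
exists (castm ((idm A ⊠ counitH (bar:=bar) H) ⊚ (coinv_mor E B : hom A' (A ⊗ K))));
  split.
- apply arr_eq_eq.
  assert (e : castm ((idm A ⊠ counitH (bar:=bar) H) ⊚ (coinv_mor E B : hom A' (A ⊗ K))) ∘ j
    ≡ (idm A ⊠ counitH (bar:=bar) H) ∘ (coinv_mor E B ∘ j)).
  { lw_goal; flat; reflexivity. }
  apply (arr_trans e). rewrite crossed_unitE. lw_goal. rw (counit_unitH hH).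
  reflexivity.
- apply arr_eq_eq.
  apply (arr_trans (g := q ∘ coinv_mor E B)).
  + lw_goal. rewrite q_E. flat. reflexivity.
  + rewrite coinv_projK; reflexivity.
Qed.
End Unit.

Lemma crossed_unit_nat {C D : strict_monoidal} {bar : strict_monoidal_functor C D}
    (c : left_braiding bar) (H : bialg_data C) (hH : is_hopf_algebra c H)
    (E : equalizers D) (A A' : cocycle_data (bar:=bar) H) (f : hom A A')
    (hf : is_cocycle_mor f) :
  crossed_unit hH E A' ∘ f =
    coinv_map E (crossed_map_cleft c hf) ∘ crossed_unit hH E A.
Proof.
apply coinv_mor_inj.
rewrite !compA, crossed_unitE, coinv_mapE, <- compA, crossed_unitE.
apply arr_eq_eq; unfold crossed_incl; lw_goal; slide.
Qed.

(** * Isomorphisms in the two categories *)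

Section Inverses.
Context {C D : strict_monoidal} {bar : strict_monoidal_functor C D} {H : bialg_data C}.

Lemma alg_mor_inv (A B : alg_data D) (f : hom A B) (f' : hom B A) :
  f' ∘ f = idm A -> f ∘ f' = idm B -> is_alg_mor f -> is_alg_mor f'.
Proof.
intros f'f ff' [fm fu]; split.
- rewrite <- (comp_idr (f' ∘ mul B)), <- tens_id, <- ff', tens_comp, compA.
  rewrite <- (compA f'), <- fm, compA, f'f, comp_idl; reflexivity.
- rewrite <- fu, compA, f'f, comp_idl; reflexivity.
Qed.

Lemma cocycle_mor_inv (A B : cocycle_data (bar:=bar) H) (f : hom A B) (f' : hom B A) :
  f' ∘ f = idm A -> f ∘ f' = idm B -> is_cocycle_mor f -> is_cocycle_mor f'.
Proof.
intros f'f ff' [[fa fv] fs]; split; [split|].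
- exact (alg_mor_inv f'f ff' fa).
- rewrite <- (comp_idr (f' ∘ act B)), <- tens_id, <- ff', tens_comp_idl, compA.
  rewrite <- (compA f'), <- fv, compA, f'f, comp_idl; reflexivity.
- rewrite <- fs, compA, f'f, comp_idl; reflexivity.
Qed.

Lemma cleft_mor_inv (A B : cleft_data (bar:=bar) H) (f : hom A B) (f' : hom B A) :
  f' ∘ f = idm A -> f ∘ f' = idm B -> is_cleft_mor f -> is_cleft_mor f'.
Proof.
intros f'f ff' [fa [fr fs]]; split; [exact (alg_mor_inv f'f ff' fa)|split].
- transitivity (((f' ∘ f) ⊠ idm (bar H)) ∘ (coact A ∘ f')).
  + rewrite f'f, tens_id, comp_idl; reflexivity.
  + rewrite tens_comp_idr, <- (compA (f' ⊠ _)), (compA (f ⊠ _)).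
    change (f ⊠ idm (bar H) ∘ coact A) with (f ⊠ idm (coalgH (bar:=bar) H) ∘ coact A).
    rewrite <- fr, <- compA, ff', comp_idr; reflexivity.
- rewrite <- fs, compA, f'f, comp_idl; reflexivity.
Qed.

Lemma cocycle_cat_iso (c : left_braiding bar) (x y : cocycle_cat c H) (f : hom x y) :
  is_iso (cocycle_mor_of f) -> is_iso f.
Proof.
intros [f' [f'f ff']].
exists (exist _ f' (cocycle_mor_inv f'f ff' (proj2_sig f))); split; apply sig_eq;
  assumption.
Qed.

Lemma cleft_cat_iso (c : left_braiding bar) (x y : cleft_cat c H) (f : hom x y) :
  is_iso (cleft_mor_of f) -> is_iso f.
Proof.
intros [f' [f'f ff']].
exists (exist _ f' (cleft_mor_inv f'f ff' (proj2_sig f))); split; apply sig_eq;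
  assumption.
Qed.
End Inverses.

Lemma naturally_isomorphic_sym (C D : category) (F G : functor C D) :
  naturally_isomorphic F G -> naturally_isomorphic G F.
Proof.
intros [t [iso_t nat_t]].
(* Invertibility only asserts existence, so the inverse components are picked by choice. *)
set (t' X := constructive_indefinite_description _ (iso_t X)).
exists (fun X => proj1_sig (t' X)); split.
- intros X; destruct (t' X) as [u [ut tu]]; exists (t X); split; assumption.
- intros X Y f.
  destruct (t' X) as [u [ut tu]], (t' Y) as [u' [u't t'u]]; cbn.
  rewrite <- (comp_idr (u' ∘ _)), <- tu, compA, <- (compA u'), <- nat_t.
  rewrite (compA u'), u't, comp_idl; reflexivity.
Qed.

(** * The two functors and their composites *)

Section Equivalence.
Context {C D : strict_monoidal} {bar : strict_monoidal_functor C D}.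
Context (c : left_braiding bar) (H : bialg_data C) (hH : is_hopf_algebra c H).
Context (E : equalizers D).
Local Notation K := (fob (smf_functor bar) (bialg_ob H)).

Definition crossed_functor : functor (cocycle_cat c H) (cleft_cat c H).
Proof.
refine (@Functor (cocycle_cat c H) (cleft_cat c H)
  (fun x => exist _ (crossed_product c (proj1_sig x)) (crossed_cleft_pair hH (proj2_sig x)))
  (fun x y f => exist _ (proj1_sig f ⊠ idm K) (crossed_map_cleft c (proj2_sig f))) _ _);
  intros; apply sig_eq; cbn; [apply tens_id | apply tens_comp_idr].
Defined.

(** The pair records only that γ^- exists; as convolution inverses are unique, the choice is
    harmless. *)
Definition section_inverse (x : cleft_cat c H) :
  {g | @is_conv_inverse D (coalgH (bar:=bar) H) (proj1_sig x) (sect (proj1_sig x)) g} :=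
  constructive_indefinite_description _ (proj2 (proj1 (proj2 (proj2_sig x)))).

Definition coinv_functor : functor (cleft_cat c H) (cocycle_cat c H).
Proof.
refine (@Functor (cleft_cat c H) (cocycle_cat c H)
  (fun x => exist _ _ (coinv_measuring_cocycle hH E (proj2_sig x)
                         (proj2_sig (section_inverse x))))
  (fun x y f => exist _ _ (coinv_map_cocycle_mor hH E (proj2_sig x) (proj2_sig y)
       (proj2_sig (section_inverse x)) (proj2_sig (section_inverse y)) (proj2_sig f))) _ _);
  intros; apply sig_eq; cbn; apply coinv_mor_inj.
- rewrite coinv_mapE, comp_idl, comp_idr; reflexivity.
- rewrite compA, !coinv_mapE, <- !compA, coinv_mapE; reflexivity.
Defined.

Lemma coinv_crossed_iso :
  naturally_isomorphic (functor_comp coinv_functor crossed_functor) (functor_id (cocycle_cat c H)).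
Proof.
(* The lift of a |-> a ⊗ 1 runs from the identity to the composite, so the direction is reversed
   first. *)
apply naturally_isomorphic_sym.
exists (fun x => exist _ _ (crossed_unit_cocycle_mor hH E (proj2_sig x)
   (proj2_sig (section_inverse (crossed_functor x))))); split.
- intros x; apply cocycle_cat_iso.
  apply (crossed_unit_iso hH E (proj2_sig x) (proj2_sig (section_inverse (crossed_functor x)))).
- intros x y f; apply sig_eq, crossed_unit_nat.
Qed.

Lemma crossed_coinv_iso :
  naturally_isomorphic (functor_comp crossed_functor coinv_functor) (functor_id (cleft_cat c H)).
Proof.
exists (fun x => exist _ _ (norm_basis_cleft_mor hH E (proj2_sig x)
   (proj2_sig (section_inverse x)))); split.
- intros x; apply cleft_cat_iso.
  apply (norm_basis_iso hH E (proj2_sig x) (proj2_sig (section_inverse x))).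
- intros x y f; apply sig_eq; cbn. apply norm_basis_nat.
Qed.
End Equivalence.

Theorem theorem3p11 (C D : strict_monoidal) (E : equalizers D)
    (bar : strict_monoidal_functor C D) (c : left_braiding bar)
    (H : bialg_data C) (hH : is_hopf_algebra c H) :
  exists (F : functor (cocycle_cat c H) (cleft_cat c H))
         (G : functor (cleft_cat c H) (cocycle_cat c H)),
    (forall x : cocycle_cat c H,
       cleft_data_of (F x) = crossed_product c (cocycle_data_of x)) /\
    (forall (x y : cocycle_cat c H) (f : hom x y),
       cleft_mor_of (fmap F f) ≡ cocycle_mor_of f ⊠ idm (bar H)) /\
    (forall x : cleft_cat c H,
       is_coinv_cocycle c E (cleft_data_of x) (cocycle_data_of (G x))) /\
    (forall (x y : cleft_cat c H) (f : hom x y),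
       exists g : hom (coinv E (cleft_data_of x)) (coinv E (cleft_data_of y)),
         unique (fun g => coinv_mor E (cleft_data_of y) ∘ g =
                          cleft_mor_of f ∘ coinv_mor E (cleft_data_of x)) g /\
         cocycle_mor_of (fmap G f) ≡ g) /\
    is_equivalence F G.
Proof.
exists (crossed_functor hH), (coinv_functor hH E).
split; [|split; [|split; [|split]]].
- reflexivity.
- reflexivity.
- intros x; apply coinv_is_coinv_cocycle.
- intros x y f; exists (cocycle_mor_of (fmap (coinv_functor hH E) f)); split;
    [|reflexivity].
  apply coinv_unique_lift, coinv_mapE.
- split; [apply coinv_crossed_iso | apply crossed_coinv_iso].
Qed.
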